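(* (1) Let $n > 1$. If $R$, regarded as a left $R$-module, is $\mathrm{FP}_n$-injective, then $(\mathrm{FP}_n\text{-inj}, (\mathrm{FP}_n\text{-inj})^{\perp})$ is a perfect cotorsion pair in the category of left $R$-modules. (2) If $R$, regarded as a left $R$-module, is $\mathrm{FP}_\infty$-injective, then $(\mathrm{FP}_\infty\text{-inj}, (\mathrm{FP}_\infty\text{-inj})^{\perp})$ is a perfect cotorsion pair in the category of left $R$-modules. Here $\mathrm{FP}_n\text{-inj}$ denotes the class of $\mathrm{FP}_n$-injective left $R$-modules.
   Context: $R$ is an associative ring with unit. For $n \ge 0$, an $R$-module is finitely $n$-presented if there is an exact sequence $F_n \to \cdots \to F_0 \to M \to 0$ with every $F_i$ finitely generated free; $\mathrm{FP}_n$ is the class of such modules, and $\mathrm{FP}_\infty$ the class of modules with a projective resolution by finitely generated free modules. A left $R$-module $N$ is $\mathrm{FP}_n$-injective ($n\ge0$ or $n=\infty$) if $\mathrm{Ext}^1_R(F,N)=0$ for every $F\in\mathrm{FP}_n$. For a class $\mathcal C$, $\mathcal C^\perp=\{X:\mathrm{Ext}^1_R(C,X)=0\ \forall C\in\mathcal C\}$, ${}^\perp\mathcal C=\{X:\mathrm{Ext}^1_R(X,C)=0\ \forall C\in\mathcal C\}$; $(\mathcal A,\mathcal B)$ is a cotorsion pair if $\mathcal A^\perp=\mathcal B$ and ${}^\perp\mathcal B=\mathcal A$. A map $f:C\to M$ with $C\in\mathcal C$ is a $\mathcal C$-cover if $\mathrm{Hom}_R(C',C)\to\mathrm{Hom}_R(C',M)$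 is surjective for all $C'\in\mathcal C$ and every $g$ with $f\circ g=f$ is an automorphism of $C$; dually, $f:M\to C$ is a $\mathcal C$-envelope if $\mathrm{Hom}_R(C,C')\to\mathrm{Hom}_R(M,C')$ is surjective for all $C'\in\mathcal C$ and every $g$ with $g\circ f=f$ is an automorphism. $\mathcal C$ is covering (enveloping) if every module has a $\mathcal C$-cover (envelope). A cotorsion pair $(\mathcal A,\mathcal B)$ is perfect if $\mathcal A$ is covering and $\mathcal B$ is enveloping. *)

(* Defs.v *)
From HB Require Import structures.
From mathcomp Require Import all_boot all_order all_algebra.
Set Implicit Arguments. Unset Strict Implicit. Unset Printing Implicit Defensive.
Import GRing.Theory.
Local Open Scope ring_scope.

Section Defs.
Variable R : pzRingType.

Definition mclass := lmodType R -> Prop.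

Definition surj (A B : Type) (f : A -> B) : Prop := forall y, exists x, f x = y.

Definition exact_at (A B C : lmodType R) (f : A -> B) (g : B -> C) : Prop :=
  forall b, g b = 0 <-> exists a, f a = b.

Definition Ext1_zero (A B : lmodType R) : Prop :=
  forall (E : lmodType R) (i : {linear B -> E}) (p : {linear E -> A}),
    injective i -> surj p -> exact_at i p ->
    exists s : {linear A -> E}, forall a, p (s a) = a.

(* finitely n-presented: F_n -> ... -> F_0 -> M -> 0 exact, F_i = R^(k i) *)
Definition FP (n : nat) (M : lmodType R) : Prop :=
  exists (k : nat -> nat)
         (d : forall i : nat, {linear 'rV[R]_(k i.+1) -> 'rV[R]_(k i)})
         (e : {linear 'rV[R]_(k 0%N) -> M}),
    [/\ surj e,
        (0 < n)%N -> exact_at (d 0%N) e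
      & forall i : nat, (i.+1 < n)%N -> exact_at (d i.+1) (d i)].

Definition FPinf (M : lmodType R) : Prop :=
  exists (k : nat -> nat)
         (d : forall i : nat, {linear 'rV[R]_(k i.+1) -> 'rV[R]_(k i)})
         (e : {linear 'rV[R]_(k 0%N) -> M}),
    [/\ surj e, exact_at (d 0%N) e
      & forall i : nat, exact_at (d i.+1) (d i)].

Definition rperp (C : mclass) : mclass :=
  fun X => forall A : lmodType R, C A -> Ext1_zero A X.
Definition lperp (C : mclass) : mclass :=
  fun X => forall B : lmodType R, C B -> Ext1_zero X B.

Definition FPn_inj (n : nat) : mclass := rperp (FP n).
Definition FPinf_inj : mclass := rperp FPinf.

Definition cotorsion_pair (A B : mclass) : Prop :=
  (forall X, rperp A X <-> B X) /\ (forall X, lperp B X <-> A X).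

Definition is_cover (C : mclass) (M D : lmodType R) (f : {linear D -> M}) : Prop :=
  [/\ C D,
      (forall (D' : lmodType R), C D' -> forall h : {linear D' -> M},
         exists g : {linear D' -> D}, forall x, f (g x) = h x)
    & forall g : {linear D -> D}, (forall x, f (g x) = f x) -> bijective g].

Definition is_envelope (C : mclass) (M D : lmodType R) (f : {linear M -> D}) : Prop :=
  [/\ C D,
      (forall (D' : lmodType R), C D' -> forall h : {linear M -> D'},
         exists g : {linear D -> D'}, forall x, g (f x) = h x)
    & forall g : {linear D -> D}, (forall x, g (f x) = f x) -> bijective g].

Definition covering (C : mclass) : Prop :=
  forall M : lmodType R, exists (D : lmodType R) (f : {linear D -> M}), is_cover C f.
Definition enveloping (C : mclass) : Prop :=
  forall M : lmodType R, exists (D : lmodType R) (f : {linear M -> D}), is_envelope C f.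

Definition perfect_cotorsion_pair (A B : mclass) : Prop :=
  [/\ cotorsion_pair A B, covering A & enveloping B].

End Defs.

(* Main.v *)
(** For a class [CC] of modules with a finite presentation of length two, a
    module [N] lies in the right orthogonal of [CC] iff certain sequences
    [N^k0 -> N^k1 -> N^k2], given by matrices over [R], are exact in the middle.
    Such a class [F] is closed under extensions, chain unions, pure submodules
    and pure quotients. An element of a module in [F] lies in a pure submodule
    of bounded size, and [F] passes to quotients by pure submodules; hence a
    module is in the right orthogonal of [F] as soon as partial maps on the free
    module over a fixed set of terms extend (Eklof's lemma). A small object
    argument embeds every module into such a module with cokernel in [F]. It
    needs no ordinals: the copies of [L] to be glued are indexed by an inductive
    type of generators, and the result is analysed along its subsets closed
    under subterms. Since [R] lies in [F], all free modules do, and Salce's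
    pushout gives special precovers, whence the cotorsion pair.

    Covers and envelopes are both minimal weakly terminal objects in a category
    of maps [M1 >-> A -> M2] with [A/M1] in [F], which has chain colimits. As in
    Enochs' argument, a weakly terminal object [G] can be replaced by one all of
    whose endomorphisms are bijective; otherwise there would be a chain of
    copies of [G] of arbitrary length with strictly increasing kernels or
    images, contradicting Cantor's theorem. *)
From Stdlib Require List.
From HB Require Import structures.
From mathcomp Require Import all_boot all_order all_algebra.
From mathcomp Require Import boolp classical_sets functions wochoice.
Require Import Defs.

Set Implicit Arguments.
Unset Strict Implicit.
Unset Printing Implicit Defensive.
Import GRing.Theory.
Local Open Scope ring_scope.

(** * Submodules and quotients *)

Section Submodules.
Variables (R : pzRingType) (A : lmodType R).
Implicit Types (P Q : A -> Prop) (x y : A).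

Definition submod P := P 0 /\ forall r x y, P x -> P y -> P (r *: x + y).

Lemma submod0 P : submod P -> P 0. Proof. by case. Qed.

Lemma submodD P x y : submod P -> P x -> P y -> P (x + y).
Proof. by move=> [_ h] px py; rewrite -[x]scale1r; apply: h. Qed.

Lemma submodZ P r x : submod P -> P x -> P (r *: x).
Proof. by move=> [h0 h] px; rewrite -[_ *: _]addr0; apply: h. Qed.

Lemma submodN P x : submod P -> P x -> P (- x).
Proof. by move=> sP px; rewrite -scaleN1r; apply: submodZ. Qed.

Lemma submodB P x y : submod P -> P x -> P y -> P (x - y).
Proof. by move=> sP px py; apply: submodD => //; apply: submodN. Qed.

Lemma submod_sum P I (r : seq I) (c : pred I) (F : I -> A) :
  submod P -> (forall i, c i -> P (F i)) -> P (\sum_(i <- r | c i) F i).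
Proof.
move=> sP h; elim/big_rec: _ => [|i x ci px]; first exact: submod0.
by apply: submodD => //; apply: h.
Qed.

Lemma submodT : submod (fun _ : A => True). Proof. by split. Qed.

Lemma submod_eq0 : submod (fun x : A => x = 0).
Proof. by split=> // r x y -> ->; rewrite scaler0 addr0. Qed.

Definition addsub P Q x := exists p q, [/\ P p, Q q & x = p + q].

Lemma addsub_submod P Q : submod P -> submod Q -> submod (addsub P Q).
Proof.
move=> sP sQ; split.
  by exists 0, 0; split; rewrite ?addr0 //; exact: submod0.
move=> r _ _ [p [q [Pp Qq ->]]] [p' [q' [Pp' Qq' ->]]].
exists (r *: p + p'), (r *: q + q'); split.
- by case: sP => _; apply.
- by case: sQ => _; apply.
- by rewrite scalerDr addrACA.
Qed.

Lemma addsubl P Q x : submod Q -> P x -> addsub P Q x.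
Proof. by move=> sQ Px; exists x, 0; split; rewrite ?addr0 //; exact: submod0. Qed.

End Submodules.

Section LinearMaps.
Variable R : pzRingType.
Implicit Types A B C : lmodType R.

Lemma linear_ex A B (f : A -> B) :
  (forall r x y, f (r *: x + y) = r *: f x + f y) ->
  exists g : {linear A -> B}, forall x, g x = f x.
Proof.
move=> lf; have lf' : linear f by [].
pose fl := GRing.isLinear.Build R A B *:%R f lf'.
pose g : {linear A -> B} := HB.pack f fl.
by exists g.
Qed.

Lemma submod_image A B (f : {linear A -> B}) :
  submod (fun y => exists x, f x = y).
Proof.
split; first by exists 0; rewrite linear0.
by move=> r _ _ [x <-] [y <-]; exists (r *: x + y); rewrite linearP.
Qed.

Lemma submod_imageP A B (f : {linear A -> B}) (P : A -> Prop) :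
  submod P -> submod (fun y => exists2 x, P x & f x = y).
Proof.
move=> [P0 PP]; split; first by exists 0; rewrite ?linear0.
by move=> r _ _ [x ? <-] [y ? <-]; exists (r *: x + y); rewrite ?linearP //; exact: PP.
Qed.

Lemma submod_preim A B (f : {linear A -> B}) (P : B -> Prop) :
  submod P -> submod (fun x => P (f x)).
Proof.
move=> sP; split; first by rewrite linear0; exact: submod0.
by move=> r x y px py; rewrite linearP; case: sP => _; apply.
Qed.

Lemma submod_ker A B (f : {linear A -> B}) : submod (fun x => f x = 0).
Proof. exact: (submod_preim f (@submod_eq0 _ _)). Qed.

Lemma linear_inj0 A B (f : {linear A -> B}) :
  (forall x, f x = 0 -> x = 0) -> injective f.
Proof.
by move=> h x y e; apply/subr0_eq/h; rewrite linearB e subrr.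
Qed.
End LinearMaps.

Section SubmoduleType.
Variables (R : pzRingType) (A : lmodType R) (P : A -> Prop).

Record subm := Subm { subm_val : A; subm_valP : P subm_val }.

Lemma subm_inj : injective subm_val.
Proof. by case=> x px [y py] /= e; subst y; congr Subm; exact: Prop_irrelevance. Qed.

(** Submodules are kept as predicates throughout; [sub_ex] and [quo_ex] produce actual modules from
    them, characterised only by an injection or a surjection. *)
Lemma sub_ex : submod P ->
  exists (S : lmodType R) (i : {linear S -> A}),
    injective i /\ forall a, P a <-> exists s, i s = a.
Proof.
move=> sP.
pose zero := Subm (submod0 sP).
pose add (x y : subm) := Subm (submodD sP (subm_valP x) (subm_valP y)).
pose opp (x : subm) := Subm (submodN sP (subm_valP x)).
pose scale r (x : subm) := Subm (submodZ r sP (subm_valP x)).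
pose T0 : choiceType := HB.pack subm (gen_eqMixin subm) (gen_choiceMixin subm).
have aA : associative add by move=> x y z; apply: subm_inj; rewrite /= addrA.
have aC : commutative add by move=> x y; apply: subm_inj; rewrite /= addrC.
have a0 : left_id zero add by move=> x; apply: subm_inj; rewrite /= add0r.
have aN : left_inverse zero opp add by move=> x; apply: subm_inj; rewrite /= addNr.
pose T1 : zmodType := HB.pack T0 (GRing.isZmodule.Build T0 aA aC a0 aN).
have sA a b (v : T1) : scale a (scale b v) = scale (a * b) v.
  by apply: subm_inj; rewrite /= scalerA.
have s1 : left_id 1 (scale : R -> T1 -> T1).
  by move=> v; apply: subm_inj; rewrite /= scale1r.
have sD : right_distributive (scale : R -> T1 -> T1) +%R.
  by move=> r x y; apply: subm_inj; rewrite /= scalerDr.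
have sDl (v : T1) : {morph (scale : R -> T1 -> T1)^~ v : a b / a + b}.
  by move=> a b; apply: subm_inj; rewrite /= scalerDl.
pose T2 : lmodType R :=
  HB.pack T1 (GRing.Zmodule_isLmodule.Build R T1 sA s1 sD sDl).
have [i ie] : exists i : {linear T2 -> A}, forall x, i x = subm_val x.
  exact: (@linear_ex R T2 A subm_val).
exists T2, i; split; first by move=> x y; rewrite !ie => /subm_inj.
move=> a; split=> [pa|[s <-]]; first by exists (Subm pa); rewrite ie.
by rewrite ie; exact: subm_valP.
Qed.
End SubmoduleType.

Section Quotients.
Variables (R : pzRingType) (A : lmodType R) (P : A -> Prop).

(** A coset is represented by one of its own elements. [choose] gives the same result for the same
    predicate, so [canon] depends only on the coset. *)
Let canon (x : A) : A := choose (fun y => `[< P (x - y) >]) x.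

Record quom := Quom { quom_val : A; quom_valP : canon quom_val = quom_val }.

Lemma quo_ex : submod P ->
  exists (S : lmodType R) (p : {linear A -> S}),
    surj p /\ forall a, p a = 0 <-> P a.
Proof.
move=> sP.
have inj : injective quom_val.
  by case=> x px [y py] /= e; subst y; congr Quom; exact: Prop_irrelevance.
have canonP x : P (x - canon x).
  apply/asboolP; rewrite /canon; apply: (@chooseP _ (fun y => `[< P (x - y) >])).
  by apply/asboolP; rewrite subrr; exact: submod0.
have canonE x y : P (x - y) -> canon x = canon y.
  move=> pxy; rewrite /canon.
  have e : (fun z => `[< P (x - z) >]) = (fun z => `[< P (y - z) >]).
    apply/funext => z; apply: asbool_equiv_eq; split=> h.
      have -> : y - z = (x - z) - (x - y).
        by rewrite opprB [RHS]addrC addrA subrK.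
      exact: submodB.
    by have -> : x - z = (x - y) + (y - z); [rewrite addrA subrK | exact: submodD].
  rewrite e; apply: choose_id; apply/asboolP.
    have -> : y - x = - (x - y) by rewrite opprB.
    exact: submodN.
  by rewrite subrr; exact: submod0.
have canonK x : canon (canon x) = canon x.
  apply: canonE; have -> : canon x - x = - (x - canon x) by rewrite opprB.
  exact: submodN.
pose cl x := Quom (canonK x).
have clE x y : P (x - y) -> cl x = cl y by move=> h; apply: inj; exact: canonE.
have clK q : cl (quom_val q) = q by apply: inj; exact: quom_valP.
have cl_eq x y : cl x = cl y -> P (x - y).
  move=> /(congr1 quom_val) /= e.
  have -> : x - y = (x - canon x) - (y - canon y).
    by rewrite e opprB addrA subrK.
  exact: submodB.
pose v := quom_val.
have vcl x : P (v (cl x) - x).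
  have -> : v (cl x) - x = - (x - canon x) by rewrite opprB.
  exact: submodN.
pose zero := cl 0.
pose add x y := cl (v x + v y).
pose opp x := cl (- v x).
pose scale r x := cl (r *: v x).
have addE x y : add (cl x) (cl y) = cl (x + y).
  by apply: clE; rewrite opprD addrACA; apply: submodD.
have oppE x : opp (cl x) = cl (- x).
  by apply: clE; rewrite -opprD; apply: submodN.
have scaleE r x : scale r (cl x) = cl (r *: x).
  by apply: clE; rewrite -scalerBr; apply: submodZ.
pose T0 : choiceType := HB.pack quom (gen_eqMixin quom) (gen_choiceMixin quom).
have aA : associative add.
  by move=> x y z; rewrite -(clK x) -(clK y) -(clK z) !addE addrA.
have aC : commutative add by move=> x y; rewrite /add addrC.
have a0 : left_id zero add by move=> x; rewrite -(clK x) addE add0r.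
have aN : left_inverse zero opp add.
  by move=> x; rewrite -(clK x) oppE addE addNr.
pose T1 : zmodType := HB.pack T0 (GRing.isZmodule.Build T0 aA aC a0 aN).
have sA a b (x : T1) : scale a (scale b x) = scale (a * b) x.
  by rewrite -(clK x) !scaleE scalerA.
have s1 : left_id 1 (scale : R -> T1 -> T1).
  by move=> x; rewrite -(clK x) scaleE scale1r.
have sD : right_distributive (scale : R -> T1 -> T1) +%R.
  move=> r x y; change (scale r (add x y) = add (scale r x) (scale r y)).
  by rewrite -(clK x) -(clK y) addE 3!scaleE addE scalerDr.
have sDl (x : T1) : {morph (scale : R -> T1 -> T1)^~ x : a b / a + b}.
  move=> a b; change (scale (a + b) x = add (scale a x) (scale b x)).
  by rewrite -(clK x) 3!scaleE addE scalerDl.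
pose T2 : lmodType R :=
  HB.pack T1 (GRing.Zmodule_isLmodule.Build R T1 sA s1 sD sDl).
have [p pe] : exists p : {linear A -> T2}, forall x, p x = cl x.
  apply: (@linear_ex R A T2 cl) => r x y.
  by rewrite -[RHS]/(add (scale _ _) _) scaleE addE.
exists T2, p; split; first by move=> q; exists (v q); rewrite pe clK.
move=> a; rewrite pe -[0]/(cl 0); split=> [/cl_eq|pa]; first by rewrite subr0.
by apply: clE; rewrite subr0.
Qed.
End Quotients.

(** * Modules defined by the exactness of finite systems *)

Section Systems.
Variable R : pzRingType.
Implicit Types A B S : lmodType R.

Definition app A m n (D : 'I_m -> 'I_n -> R) (y : 'I_n -> A) : 'I_m -> A :=
  fun i => \sum_j D i j *: y j.

Lemma appP A m n (D : 'I_m -> 'I_n -> R) (P : A -> Prop) y i :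
  submod P -> (forall j, P (y j)) -> P (app D y i).
Proof. by move=> sP py; apply: submod_sum => // j _; apply: submodZ. Qed.

Lemma app_linear A B (f : {linear A -> B}) m n (D : 'I_m -> 'I_n -> R) y i :
  f (app D y i) = app D (fun j => f (y j)) i.
Proof. by rewrite linear_sum; apply: eq_bigr => j _; rewrite linearZ. Qed.

Lemma appD A m n (D : 'I_m -> 'I_n -> R) (x y : 'I_n -> A) i :
  app D (fun j => x j + y j) i = app D x i + app D y i.
Proof. by rewrite -big_split; apply: eq_bigr => j _; rewrite scalerDr. Qed.

Lemma appB A m n (D : 'I_m -> 'I_n -> R) (x y : 'I_n -> A) i :
  app D (fun j => x j - y j) i = app D x i - app D y i.
Proof. by rewrite -sumrB; apply: eq_bigr => j _; rewrite scalerBr. Qed.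

Lemma app0 A m n (D : 'I_m -> 'I_n -> R) i : app D (fun _ => 0 : A) i = 0.
Proof. by rewrite /app big1 // => j _; rewrite scaler0. Qed.

Lemma appC A k0 k1 k2 (D1 : 'I_k1 -> 'I_k0 -> R) (D2 : 'I_k2 -> 'I_k1 -> R)
    (x : 'I_k0 -> A) i :
  (forall i l, \sum_j D2 i j * D1 j l = 0) -> app D2 (app D1 x) i = 0.
Proof.
move=> h; rewrite /app.
transitivity (\sum_l \sum_j (D2 i j * D1 j l) *: x l).
  rewrite exchange_big /=; apply: eq_bigr => j _; rewrite scaler_sumr.
  by apply: eq_bigr => l _; rewrite scalerA.
by rewrite big1 // => l _; rewrite -scaler_suml h scale0r.
Qed.
End Systems.

Definition pairs (R : pzRingType) :=
  forall k0 k1 k2 : nat, ('I_k1 -> 'I_k0 -> R) -> ('I_k2 -> 'I_k1 -> R) -> Prop.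

Section ClassF.
Variables (R : pzRingType) (DD : pairs R).
Hypothesis DDc : forall k0 k1 k2 (D1 : 'I_k1 -> 'I_k0 -> R) (D2 : 'I_k2 -> 'I_k1 -> R),
  DD D1 D2 -> forall i l, \sum_j D2 i j * D1 j l = 0.
Implicit Types A B S : lmodType R.

(* The subquotient Q/P lies in the class of the modules N for which all the
   sequences N^k0 -> N^k1 -> N^k2 given by DD are exact in the middle. *)
Definition relF A (Q P : A -> Prop) :=
  forall k0 k1 k2 (D1 : 'I_k1 -> 'I_k0 -> R) (D2 : 'I_k2 -> 'I_k1 -> R),
  DD D1 D2 -> forall y, (forall j, Q (y j)) -> (forall i, P (app D2 y i)) ->
  exists2 x, forall l, Q (x l) & forall j, P (y j - app D1 x j).

Definition inF A := relF (fun _ : A => True) (fun a => a = 0).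

(** Solve modulo Q first. The remainder lies in Q and is still a cycle modulo P, because [D2]
    composed with [D1] vanishes, so a second solution inside Q finishes. *)
Lemma relF_ext A (P Q Q' : A -> Prop) :
  submod P -> submod Q -> submod Q' -> (forall x, P x -> Q x) ->
  (forall x, Q x -> Q' x) -> relF Q P -> relF Q' Q -> relF Q' P.
Proof.
move=> sP sQ sQ' PQ QQ' F1 F2 k0 k1 k2 D1 D2 D12 y Qy Py.
have [x' Qx' e'] := F2 _ _ _ _ _ D12 y Qy (fun i => PQ _ (Py i)).
have [|x Qx e] := F1 _ _ _ _ _ D12 _ e'.
  by move=> i; rewrite appB (appC _ _ (DDc D12)) subr0.
exists (fun l => x' l + x l) => [l|j]; first by apply: submodD => //; exact: QQ'.
by rewrite appD opprD addrA.
Qed.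

(** The hypotheses say that h induces an isomorphism from Q/P to Q'/P', expressed without forming
    either quotient. *)
Lemma relF_transfer A B (h : {linear A -> B}) (Q P : A -> Prop) (Q' P' : B -> Prop) :
  submod Q -> submod P' ->
  (forall a, Q a -> Q' (h a)) ->
  (forall b, Q' b -> exists2 a, Q a & P' (b - h a)) ->
  (forall a, Q a -> (P a <-> P' (h a))) ->
  relF Q P <-> relF Q' P'.
Proof.
move=> sQ sP' hQ oQ hP; split=> F k0 k1 k2 D1 D2 D12 y Qy Py.
  have /choice[z zP] : forall j, exists a, Q a /\ P' (y j - h a).
    by move=> j; have [a] := oQ _ (Qy j); exists a.
  have [||x Qx e] := F _ _ _ _ _ D12 z.
  - by move=> j; case: (zP j).
  - move=> i; apply/hP; first by apply: appP => // j; case: (zP j).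
    rewrite (app_linear h).
    have -> : app D2 (fun j => h (z j)) i
              = app D2 y i - app D2 (fun j => y j - h (z j)) i.
      by rewrite appB opprB addrC subrK.
    by apply: submodB => //; apply: appP => // j; case: (zP j).
  exists (fun l => h (x l)) => [l|j]; first exact: hQ.
  have -> : y j - app D1 (fun l => h (x l)) j
            = (y j - h (z j)) + h (z j - app D1 x j).
    by rewrite linearB (app_linear h) addrA subrK.
  apply: submodD => //; first by case: (zP j).
  apply/hP; last exact: e.
  by apply: submodB => //; [case: (zP j) | exact: appP].
have [||x Qx e] := F _ _ _ _ _ D12 (fun j => h (y j)).
- by move=> j; apply: hQ.
- by move=> i; rewrite -(app_linear h); apply/hP => //; exact: appP.
have /choice[z zP] : forall j, exists a, Q a /\ P' (x j - h a).
  by move=> j; have [a] := oQ _ (Qx j); exists a.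
exists z => [l|j]; first by case: (zP l).
have Qz : Q (y j - app D1 z j).
  by apply: submodB => //; apply: appP => // l; case: (zP l).
apply/hP => //; rewrite linearB (app_linear h).
have -> : h (y j) - app D1 (fun l => h (z l)) j
  = (h (y j) - app D1 x j) + app D1 (fun l => x l - h (z l)) j.
  by rewrite appB addrA subrK.
by apply: submodD => //; apply: appP => // l; case: (zP l).
Qed.

Lemma inF_sub A S (i : {linear S -> A}) (Q : A -> Prop) :
  injective i -> (forall a, Q a <-> exists s, i s = a) ->
  inF S <-> relF Q (fun a => a = 0).
Proof.
move=> inj iQ; apply: (relF_transfer (h := i)).
- exact: submodT.
- exact: submod_eq0.
- by move=> s _; apply/iQ; exists s.
- by move=> b /iQ[s <-]; exists s; rewrite ?subrr.
- move=> s _; split=> [->|]; first by rewrite linear0.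
  by rewrite -(linear0 i) => /inj.
Qed.

Lemma inF_quo A S (p : {linear A -> S}) (P : A -> Prop) :
  surj p -> (forall a, p a = 0 <-> P a) ->
  inF S <-> relF (fun=> True) P.
Proof.
move=> sj pP; apply: iff_sym; apply: (relF_transfer (h := p)) => //.
- exact: submod_eq0.
- by move=> b _; have [a <-] := sj b; exists a; rewrite ?subrr.
- by move=> a _; apply: iff_sym.
Qed.

Lemma inF_retract A S (i : {linear S -> A}) (p : {linear A -> S}) :
  (forall s, p (i s) = s) -> inF A -> inF S.
Proof.
move=> pi FA k0 k1 k2 D1 D2 D12 y _ y0.
have [//||x _ e] := FA _ _ _ _ _ D12 (fun j => i (y j)).
  by move=> k; rewrite -(app_linear i) y0 linear0.
exists (fun l => p (x l)) => // j.
by rewrite -(app_linear p) -[y j]pi -linearB e linear0.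
Qed.

Lemma chain_finite (T : Type) (F : set (set T)) k (y : 'I_k -> T) :
  total_on F subset -> (exists X, F X) ->
  (forall j, exists2 X, F X & X (y j)) ->
  exists2 X, F X & forall j, X (y j).
Proof.
move=> tot [X0 FX0]; elim: k y => [|k IH] y h.
  by exists X0 => // -[].
have [X FX hX] := IH (fun j => y (lift ord0 j)) (fun j => h _).
have [Y FY hY] := h ord0.
have [XY|YX] := tot _ _ FX FY.
  exists Y => // j; have [->//|] := eqVneq j ord0.
  by rewrite eq_sym => /unlift_some[j' -> _]; apply/XY/hX.
exists X => // j; have [->//|] := eqVneq j ord0; first exact: YX.
by rewrite eq_sym => /unlift_some[j' -> _]; apply/hX.
Qed.

(** Each instance involves finitely many elements, so it already takes place inside one member of
    the chain. *)
Lemma relF_chain A (F : set (set A)) (P : A -> Prop) :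
  total_on F subset -> (exists X, F X) ->
  (forall X, F X -> relF X P) ->
  relF (fun a => exists2 X, F X & X a) P.
Proof.
move=> tot ne FX k0 k1 k2 D1 D2 D12 y Qy Py.
have [X FX' Xy] := chain_finite tot ne Qy.
have [x Xx e] := FX _ FX' _ _ _ _ _ D12 y Xy Py.
by exists x => // l; exists X.
Qed.

Lemma relF_refl A (P : A -> Prop) : submod P -> relF P P.
Proof.
move=> sP k0 k1 k2 D1 D2 D12 y Py _; exists (fun=> 0) => [l|j]; first exact: submod0.
by rewrite app0 subr0.
Qed.

End ClassF.

(** * Direct sums as finitely supported functions *)

Section FiniteSupport.
Variables (R : pzRingType) (J : Type) (L : lmodType R).

(** The support is only bounded by a list, and [List.In] is used since J is an arbitrary type
    without decidable equality. *)
Definition finsupp (f : J -> L) := exists s : seq J, forall j, ~ List.In j s -> f j = 0.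

Lemma finsupp_submod : submod finsupp.
Proof.
split; first by exists [::].
move=> r f g [s hs] [t ht]; exists (s ++ t) => j js.
rewrite addrfctE scalrfctE hs ?ht ?scaler0 ?addr0 // => h; apply: js.
  by apply/List.in_app_iff; right.
by apply/List.in_app_iff; left.
Qed.

Definition single (j : J) (x : L) : J -> L := fun i => if pselect (i = j) then x else 0.

Lemma single_linear j : exists f : {linear L -> (J -> L)}, forall x, f x = single j x.
Proof.
apply: linear_ex => r x y; apply/funext => i; rewrite /single addrfctE scalrfctE.
by case: pselect => ? //=; rewrite scaler0 addr0.
Qed.

Lemma single_supp j x : finsupp (single j x).
Proof.
by exists [:: j] => i h; rewrite /single; case: pselect => // e; case: h; left.
Qed.

Lemma singleE j x : single j x j = x.
Proof. by rewrite /single; case: pselect. Qed.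

Lemma single_ne i j x : i <> j -> single j x i = 0.
Proof. by rewrite /single; case: pselect. Qed.

Lemma finsupp_sum f : finsupp f ->
  exists n (e : 'I_n -> J) (l : 'I_n -> L), f = \sum_(k < n) single (e k) (l k).
Proof.
case=> s; elim: s f => [|j s IH] f h.
  exists 0%N, (fun k : 'I_0 => match notF (ltn_ord k) with end), (fun=> 0).
  by rewrite big_ord0; apply/funext => j; exact: h.
have [|n [e [l E]]] := IH (f - single j (f j)).
  move=> i hi; rewrite addrfctE opprfctE.
  have [->|ne] := pselect (i = j); first by rewrite singleE subrr.
  rewrite single_ne // subr0 h //; case; last exact: hi.
  by move=> ij; apply: ne.
exists n.+1, (fun k => if unlift ord0 k is Some k' then e k' else j),
  (fun k => if unlift ord0 k is Some k' then l k' else f j).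
rewrite big_ord_recl unlift_none.
by under eq_bigr do rewrite liftK; rewrite -E addrC subrK.
Qed.

(** The system is solved coordinatewise. Taking the zero solution off a common support of the
    right-hand sides keeps the solution finitely supported. *)
Lemma relF_finsupp (DD : pairs R) : inF DD L -> relF DD finsupp (fun f => f = 0).
Proof.
move=> FL k0 k1 k2 D1 D2 D12 y Qy y0.
have appE m n (D : 'I_m -> 'I_n -> R) (f : 'I_n -> J -> L) i t :
    app D f i t = app D (fun j => f j t) i.
  by rewrite /app fct_sumE.
have [s hs] : exists s : seq J, forall j t, ~ List.In t s -> y j t = 0.
  have /choice[s hs] := Qy.
  exists (flatten [seq s j | j <- enum 'I_k1]) => j t ht; apply: hs => h; apply: ht.
  have : j \in enum 'I_k1 by rewrite mem_enum.
  elim: (enum 'I_k1) => // a q IH; rewrite inE => /orP[/eqP <-|/IH h'].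
    by apply/List.in_app_iff; left.
  by apply/List.in_app_iff; right.
have /choice[x hx] : forall t, exists x : 'I_k0 -> L,
    (forall j, y j t = app D1 x j) /\ (~ List.In t s -> x = fun=> 0).
  move=> t; have [ts|ts] := pselect (List.In t s); last first.
    by exists (fun=> 0); split=> // j; rewrite app0 hs.
  have [//||x _ e] := FL _ _ _ _ _ D12 (fun j => y j t).
    by move=> i; rewrite -appE y0.
  by exists x; split=> // j; apply/subr0_eq/e.
exists (fun l t => x t l) => [l|j].
  by exists s => t ts; have [_ ->] := hx t.
apply/funext => t; rewrite addrfctE opprfctE appE.
by have [<- _] := hx t; rewrite subrr.
Qed.

End FiniteSupport.

(** * Free modules, purity and Eklof's lemma *)

Section FreeModules.
Variable R : pzRingType.

(** Uniqueness of the extension is replaced by the second clause, which says that the family d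
    generates L, in the form of an induction principle. *)
Definition is_free (J : Type) (L : lmodType R) (d : J -> L) :=
  (forall (A : lmodType R) (f : J -> A),
     exists g : {linear L -> A}, forall j, g (d j) = f j) /\
  (forall N : L -> Prop, submod N -> (forall j, N (d j)) -> forall x, N x).

(** The value at x is a sum over any duplicate-free list containing the support; terms with zero
    coefficient do not matter, so the list is immaterial. Off the finitely supported functions the
    value is junk. *)
Lemma finsupp_ext (J : Type) (A : lmodType R) (f : J -> A) :
  exists g : (J -> R^o) -> A,
    (forall r x y, finsupp x -> finsupp y -> g (r *: x + y) = r *: g x + g y) /\
    forall j, g (single (L := (R^o : lmodType R)) j (1 : R)) = f j.
Proof.
pose supp (x : J -> R^o) (s : seq {classic J}) :=
  uniq s /\ forall j, j \notin s -> x j = 0.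
pose val (x : J -> R^o) (s : seq {classic J}) := \sum_(j <- s) (x j : R) *: f j.
have supp_ex x : finsupp x -> exists s, supp x s.
  case=> s hs; exists (undup (s : seq {classic J})); split; first exact: undup_uniq.
  move=> j; rewrite mem_undup => js; apply: hs => h; case/negP: js.
  elim: s h => //= a s IH [->|/IH h]; rewrite inE ?eqxx //.
  by rewrite h orbT.
have val_indep x s t : supp x s -> supp x t -> val x s = val x t.
  have valE u : val x u = \sum_(j <- u | (x j : R) != 0) (x j : R) *: f j.
    rewrite /val big_mkcond [RHS]big_mkcond; apply: eq_bigr => j _ /=.
    by case: eqP => //= ->; rewrite scale0r.
  move=> [us hs] [ut ht]; rewrite (valE s) (valE t) -[LHS]big_filter -[RHS]big_filter; apply: perm_big.
  apply: uniq_perm; rewrite ?filter_uniq // => j; rewrite !mem_filter.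
  case: eqP => //= /eqP xj; apply/idP/idP => _.
    by apply: contraNT xj => /ht ->.
  by apply: contraNT xj => /hs ->.
have /choice[g hg] : forall x, exists v, finsupp x ->
    exists2 s, supp x s & v = val x s.
  move=> x; have [/supp_ex[s hs]|h] := pselect (finsupp x); last by exists 0.
  by exists (val x s) => _; exists s.
exists g; split=> [r x y fx fy|j].
  have fxy : finsupp (r *: x + y) by case: (finsupp_submod J (R^o : lmodType R)) => _; apply.
  have [[[s ss ->] [t st ->]] [u hu ->]] := (hg _ fx, hg _ fy, hg _ fxy).
  (* A common list for x, y and their combination, over which additivity is checked term by term. *)
  pose w : seq {classic J} := undup (s ++ t).
  have sw z v : supp z v -> {subset v <= w} -> supp z w.
    move=> [_ h] vw; split; first exact: undup_uniq.
    by move=> j jw; apply: h; apply: contra jw => /vw.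
  have xw : supp x w by apply: (sw _ s) => // j js; rewrite mem_undup mem_cat js.
  have yw : supp y w by apply: (sw _ t) => // j js; rewrite mem_undup mem_cat js orbT.
  have zw : supp (r *: x + y) w.
    case: xw yw => uw xw [_ yw]; split=> // j jw.
    by rewrite addrfctE scalrfctE xw // yw // scaler0 addr0.
  rewrite (val_indep _ _ _ hu zw) (val_indep _ s w) // (val_indep _ t w) //.
  rewrite scaler_sumr -big_split; apply: eq_bigr => j _.
  by rewrite addrfctE scalrfctE scalerDl scalerA.
have [s hs ->] := hg _ (single_supp (L := (R^o : lmodType R)) j (1 : R)).
rewrite (val_indep _ _ [:: j] hs); last first.
  by split=> // i; rewrite inE => /eqP ij; rewrite single_ne.
by rewrite /val big_seq1 singleE scale1r.
Qed.

(** The assumption that R lies in the class enters here: L is the direct sum of copies of R indexed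
    by J. *)
Lemma free_ex (DD : pairs R) (J : Type) : inF DD (R^o : lmodType R) ->
  exists (L : lmodType R) (d : J -> L), inF DD L /\ is_free d.
Proof.
move=> FR.
have [L [i [inj iE]]] := sub_ex (finsupp_submod J (R^o : lmodType R)).
have /choice[d dE] : forall j, exists l, i l = single (L := (R^o : lmodType R)) j (1 : R).
  by move=> j; apply/iE; exact: single_supp.
exists L, d; split.
  by apply/(inF_sub DD inj iE); exact: relF_finsupp.
split; last first.
  move=> N sN Nd x.
  have [|n [e [l E]]] := @finsupp_sum _ _ _ (i x); first by apply/iE; exists x.
  suff -> : x = \sum_(k < n) (l k : R) *: d (e k).
    by apply: submod_sum => // k _; apply: submodZ.
  apply: inj; rewrite E linear_sum; apply: eq_bigr => k _; rewrite linearZ dE.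
  apply/funext => j.
  change (single (e k) (l k) j = (l k : R) * single (L := (R^o : lmodType R)) (e k) (1 : R) j).
  by rewrite /single; case: pselect => ? /=; rewrite ?mulr1 ?mulr0.
move=> A f; have [g [gl gE]] := finsupp_ext f.
have [h hE] : exists h : {linear L -> A}, forall x, h x = g (i x).
  apply: linear_ex => r x y; rewrite linearP gl //; apply/iE.
    by exists x.
  by exists y.
by exists h => j; rewrite hE dE.
Qed.
End FreeModules.

(** The empty set is adjoined to P so that the empty chain has a bound; the member [X0] then rules
    out that the maximal set is only this artificial one. The maximal set need not contain [X0]. *)
Lemma Zorn_ne (T : Type) (P : set (set T)) (X0 : set T) : P X0 ->
  (forall F : set (set T), (exists X, F X) -> (forall X, F X -> P X) ->
     total_on F subset -> P (fun t => exists2 X, F X & X t)) ->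
  exists2 A, P A & forall B, P B -> (forall x, A x -> B x) -> forall x, B x -> A x.
Proof.
move=> P0 hP.
have [F FP tot|A [PA mA]] := @Zorn_bigcup T (fun X => P X \/ X = set0).
  have [[X FX PX]|h] := pselect (exists2 X, F X & P X).
    left; pose F' := fun X => F X /\ P X.
    have -> : (\bigcup_(X in F) X)%classic = (fun t => exists2 X, F' X & X t).
      rewrite predeqE => t; split=> [[Y FY Yt]|[Y [FY _] Yt]]; exists Y => //.
      by split=> //; have [//|Y0] := FP _ FY; move: Yt; rewrite Y0.
    by apply: hP; [exists X | move=> Y [] | move=> Y Z [? _] [? _]; exact: tot].
  right; rewrite predeqE => t; split=> // -[X FX Xt].
  have [PX|X0'] := FP _ FX; first by case: h; exists X.
  by move: Xt; rewrite X0'.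
exists A.
  case: PA => // A0; have [<-//|X0N] := pselect (X0 = A).
  case: (mA X0); last by left.
  rewrite A0; split=> // h; apply: X0N; rewrite A0 predeqE => t.
  by split=> // /h.
move=> B PB AB x Bx; apply: contrapT => nAx; apply: (mA B); last by left.
by split=> // h; apply/nAx/h.
Qed.

(** * Pure submodules and Eklof's lemma *)

Section Purity.
Variable R : pzRingType.
Implicit Types A : lmodType R.

Definition pure A (P : A -> Prop) :=
  forall m n (D : 'I_m -> 'I_n -> R) (x : 'I_n -> A), (forall i, P (app D x i)) ->
  exists2 z, forall j, P (z j) & forall i, app D z i = app D x i.

(** A cycle modulo P becomes a true cycle after subtracting some z in P with the same image under
    [D2]; purity provides z. *)
Lemma pure_quo (DD : pairs R) A (P : A -> Prop) :
  submod P -> pure P -> inF DD A -> relF DD (fun=> True) P.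
Proof.
move=> sP pP FA k0 k1 k2 D1 D2 D12 y _ Py.
have [z Pz e] := pP _ _ _ _ Py.
have [//||x _ ex] := FA _ _ _ _ _ D12 (fun j => y j - z j).
  by move=> i; rewrite appB e subrr.
exists x => // j; suff -> : y j - app D1 x j = z j by [].
by apply/eqP; rewrite subr_eq addrC -subr_eq; apply/eqP/subr0_eq/ex.
Qed.

(* [tsol D c j] stands for the j-th entry of a chosen solution of D x = c modulo P,
   with junk value 0 if there is none. *)
Inductive trm :=
| tbase
| tadd of trm & trm
| tscale of R & trm
| tsol m n (D : 'I_m -> 'I_n -> R) (c : 'I_m -> trm) (j : 'I_n).

Section Hull.
Variables (A : lmodType R) (P : A -> Prop) (a : A).

Fixpoint ev (t : trm) : A :=
  match t with
  | tbase => a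
  | tadd t u => ev t + ev u
  | tscale r t => r *: ev t
  | tsol m n D c j =>
      match pselect (exists x : 'I_n -> A, forall i, P (app D x i - ev (c i))) with
      | left h => projT1 (cid h) j
      | right _ => 0
      end
  end.

(** The set of terms depends on R alone, so it bounds the size of the hull modulo P whatever the
    module A is. *)
Definition hull (q : A) := exists t, P (q - ev t).

Hypotheses (sP : submod P) (pP : pure P).

Lemma hull_sub q : P q -> hull q.
Proof. by move=> Pq; exists (tscale 0 tbase); rewrite /= scale0r subr0. Qed.

Lemma hull_submod : submod hull.
Proof.
split; first by apply: hull_sub; exact: submod0.
move=> r x y [t ht] [u hu]; exists (tadd (tscale r t) u) => /=.
rewrite opprD addrACA -scalerBr; apply: submodD => //; exact: submodZ.
Qed.

Lemma hull_base : hull a.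
Proof. by exists tbase; rewrite /= subrr; exact: submod0. Qed.

(** A term built with [tsol] names a solution modulo P inside the hull. Its difference from the
    given solution has image in P, and purity of P supplies the correction. *)
Lemma hull_pure : pure hull.
Proof.
move=> m n D x hx; have /choice[c hc] := hx.
have [x0 ex0] : exists x0 : 'I_n -> A,
    (forall j, hull (x0 j)) /\ forall i, P (app D x0 i - ev (c i)).
  have h : exists x : 'I_n -> A, forall i, P (app D x i - ev (c i)) by exists x.
  exists (fun j => ev (tsol D c j)); split.
    by move=> j; exists (tsol D c j); rewrite subrr; exact: submod0.
  rewrite /=; case: pselect => // h' i; exact: (projT2 (cid h')).
case: ex0 => hx0 ex0.
have [|z Pz ez] := pP (D := D) (x := fun j => x0 j - x j).
  move=> i; rewrite appB.
  have -> : app D x0 i - app D x i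
     = (app D x0 i - ev (c i)) - (app D x i - ev (c i)) by rewrite opprB addrA subrK.
  exact: submodB.
exists (fun j => x0 j - z j) => [j|i].
  by apply: submodB => //; [exact: hull_submod | exact: hull_sub].
by rewrite appB ez appB opprB addrC subrK.
Qed.

(** The system is solved modulo P in all of A, by purity of P, and the solution is then moved into
    the hull, by purity of the hull. *)
Lemma hull_relF (DD : pairs R) : inF DD A -> relF DD hull P.
Proof.
move=> FA k0 k1 k2 D1 D2 D12 y hy Py.
have [x _ ex] := pure_quo sP pP FA D12 (fun=> I) Py.
have [|z hz ez] := hull_pure (D := D1) (x := x).
  move=> i; have -> : app D1 x i = y i - (y i - app D1 x i) by rewrite subKr.
  by apply: submodB => //; [exact: hull_submod | exact: hull_sub].
by exists z => // j; rewrite ez.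
Qed.
End Hull.

(** A partial linear map is a total function with arbitrary values off K, which avoids a module type
    for the domain. *)
Definition lin_on (L X : lmodType R) (K : L -> Prop) (th : L -> X) :=
  forall r x y, K x -> K y -> th (r *: x + y) = r *: th x + th y.

Definition ext_prop (L X : lmodType R) (K : L -> Prop) :=
  forall th : L -> X, lin_on K th ->
  exists g : {linear L -> X}, forall x, K x -> g x = th x.

(* Eklof's lemma, with a maximal partial section whose domain is pure in
   place of a filtration. *)
Lemma eklof (DD : pairs R) (L : lmodType R) (d : trm -> L) (X : lmodType R) :
  is_free d ->
  (forall N : L -> Prop, submod N -> relF DD (fun=> True) N -> ext_prop X N) ->
  forall A, inF DD A -> Ext1_zero A X.
Proof.
move=> freeL hX A FA E i p inji sjp exip.
pose im (G : E -> Prop) (b : A) := exists2 e, G e & p e = b.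
(* G is the image of a partial section of p: p is injective on G, and p(G) is the domain, required
   to be pure. *)
pose PP (G : E -> Prop) := [/\ submod G, forall e, G e -> p e = 0 -> e = 0 & pure (im G)].
have [||G [sG G0 pG] mG] := @Zorn_ne E PP (fun e => e = 0).
- split; first exact: submod_eq0.
  + by [].
  + move=> m n D x h; exists (fun=> 0).
      by move=> j; exists 0; rewrite ?linear0.
    by move=> k; rewrite app0; have [e -> <-] := h k; rewrite linear0.
- move=> F ne FP tot; split.
  + have [X0 FX0] := ne; split.
      by exists X0 => //; case: (FP _ FX0) => /submod0.
    move=> r x y [Y FY Yx] [Z FZ Zy].
    have [YZ|ZY] := tot _ _ FY FZ; [exists Z|exists Y] => //.
      by case: (FP _ FZ) => -[_ h] _ _; apply: h => //; apply: YZ.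
    by case: (FP _ FY) => -[_ h] _ _; apply: h => //; apply: ZY.
  + by move=> e [Y FY Ye]; case: (FP _ FY) => _ h _; exact: h.
  + move=> m n D x h.
    have /choice[e eP] : forall k, exists e,
        (exists2 Y, F Y & Y e) /\ p e = app D x k.
      by move=> k; have [e] := h k; exists e.
    have [|Y FY Ye] := chain_finite tot ne (y := e).
      by move=> k; case: (eP k).
    have [_ _ pY] := FP _ FY.
    have [|z Yz ez] := pY _ _ D x.
      by move=> k; exists (e k) => //; case: (eP k).
    by exists z => // j; have [f Yf <-] := Yz j; exists f => //; exists Y.
have Guniq e e' : G e -> G e' -> p e = p e' -> e = e'.
  move=> Ge Ge' epp; apply/subr0_eq/G0; first exact: submodB.
  by rewrite linearB epp subrr.
have simG : submod (im G) by exact: submod_imageP.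
suff full a : im G a.
  have /choice[s sP] : forall a, exists e, G e /\ p e = a.
    by move=> a; have [e] := full a; exists e.
  have [s' s'E] : exists s' : {linear A -> E}, forall x, s' x = s x.
    apply: linear_ex => r x y; apply: Guniq.
    - by case: (sP (r *: x + y)).
    - by case: sG => _; apply; [case: (sP x) | case: (sP y)].
    - by rewrite linearP !(fun x => proj2 (sP x)).
  by exists s' => x; rewrite s'E; case: (sP x).
(* The section is to be extended from P to the pure hull Q of P and a. Sending each basis element to
   a lift of the value of its term gives [et], for which L maps onto Q/P. *)
pose P := im G; pose Q := hull P a.
have /choice[lf lfE] : forall t, exists e, p e = ev P a t by move=> t; apply: sjp.
have [et etE] := freeL.1 _ lf.
have sQ : submod Q by exact: hull_submod.
have etQ x : Q (p (et x)).
  apply: (freeL.2 (fun x => Q (p (et x)))); last first.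
    by move=> t; rewrite etE lfE; exists t; rewrite subrr; exact: submod0.
  by split=> [|r y z]; rewrite ?linear0 ?linearP; case: sQ => // ? h; exact: h.
pose N x := P (p (et x)).
have sN : submod N.
  by split=> [|r y z]; rewrite /N ?linear0 ?linearP; case: simG => // ? h; exact: h.
(* L/N is isomorphic to Q/P, which lies in the class. *)
have FN : relF DD (fun=> True) N.
  have [pe peE] : exists f : {linear L -> A}, forall x, f x = p (et x).
    by apply: linear_ex => r x y; rewrite !linearP.
  apply/(relF_transfer DD (h := pe) (Q' := Q) (P' := P)) => //.
  - by move=> x _; rewrite peE.
  - move=> b [t ht]; exists (d t) => //; by rewrite peE etE lfE.
  - by move=> x _; rewrite peE.
  - exact: hull_relF.
(* On N, [et] and the partial section agree after applying p, so they differ by an element of X.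
   This difference is the partial map to be extended. *)
have /choice[th thE] : forall x, exists v, N x -> exists g, [/\ G g, p g = p (et x) & et x - g = i v].
  move=> x; have [[g Gg e]|h] := pselect (N x); last by exists 0.
  have [|v hv] := (exip (et x - g)).1; first by rewrite linearB e subrr.
  by exists v => _; exists g.
have [|th' th'E] := hX N sN FN th.
  move=> r x y Nx Ny; have Nxy : N (r *: x + y) by case: sN => _; apply.
  have [[[g [Gg e1 e2]] [g' [Gg' e1' e2']]] [g'' [Gg'' e1'' e2'']]]
    := (thE _ Nx, thE _ Ny, thE _ Nxy).
  apply: inji; rewrite (linearP i) -e2 -e2' -e2''.
  suff -> : g'' = r *: g + g' by rewrite (linearP et) scalerBr opprD addrACA.
  apply: Guniq => //; first by case: sG => _; apply.
  by rewrite e1'' !linearP e1 e1'.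
(* The corrected map f sends N into G, so p remains injective on G + f(L), whose image is Q. *)
have [f fE] : exists f : {linear L -> E}, forall x, f x = et x - i (th' x).
  by apply: linear_ex => r x y; rewrite (linearP et) (linearP th') (linearP i) scalerBr opprD addrACA.
have pi v : p (i v) = 0 by apply/exip; exists v.
have pf x : p (f x) = p (et x) by rewrite fE linearB pi subr0.
pose G' := addsub G (fun e => exists x, f x = e).
have sf := submod_image f.
have imG' b : im G' b <-> Q b.
  split=> [[_ [g [_ [Gg [x <-] ->]]] <-]|[t ht]].
    rewrite linearD pf; apply: submodD => //; apply: hull_sub.
    by exists g.
  have [g Gg ge] := ht; exists (g + f (d t)); first by exists g, (f (d t)); split=> //; exists (d t).
  by rewrite linearD pf etE lfE ge subrK.
apply: contrapT => na.
have /mG/(_ _) GG' : PP G'.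
  split; first exact: addsub_submod.
  - move=> _ [g [_ [Gg [x <-] ->]]]; rewrite linearD pf => e0.
    have Nx : N x.
      by exists (- g); [exact: submodN | rewrite linearN; apply/eqP; rewrite eq_sym -addr_eq0 addrC e0].
    have [g' [Gg' e1 e2]] := thE _ Nx.
    rewrite fE th'E // -e2 subKr; apply: G0; first exact: submodD.
    by rewrite linearD e1.
  - move=> m n D x h; have [|z hz ez] := hull_pure simG pG (D := D) (x := x) (a := a).
      by move=> k; apply/imG'.
    by exists z => // j; apply/imG'; exact: hz.
apply: na; have [|e G'e <-] := (imG' a).2; first exact: hull_base.
by exists e => //; apply: GG' => // g Gg; apply: addsubl.
Qed.
End Purity.

(** * The small object argument *)

Section Subquotient.
Variables (R : pzRingType) (A : lmodType R) (Q P : A -> Prop).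
Hypotheses (sQ : submod Q) (sP : submod P).

(** The projection c is a total function on A, meaningful only on Q. The last clause transports
    membership in the class to quotients of Q/P. *)
Lemma subquotient_ex : exists (C : lmodType R) (c : A -> C),
  [/\ lin_on Q c,
      forall x, exists2 a, Q a & c a = x,
      forall a b, Q a -> Q b -> (c a = c b <-> P (a - b)) &
      forall (DD : pairs R) (Z : C -> Prop), submod Z ->
        relF DD Q (fun a => Z (c a)) -> relF DD (fun=> True) Z].
Proof.
have [S [j [jinj jE]]] := sub_ex sQ.
have [C [q [qs qE]]] := quo_ex (submod_preim j sP).
have /choice[lft lftE] : forall t, exists s, Q t -> j s = t.
  move=> t; have [/jE[s <-]|h] := pselect (Q t); first by exists s.
  by exists 0.
have cs x : exists2 a, Q a & q (lft a) = x.
  have [s <-] := qs x; have Qs : Q (j s) by apply/jE; exists s.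
  by exists (j s) => //; congr (q _); apply: jinj; rewrite lftE.
have lin : lin_on Q (fun a => q (lft a)).
  move=> r x y Qx Qy /=; rewrite -linearP; congr (q _); apply: jinj.
  by rewrite linearP !lftE //; case: sQ => _; apply.
exists C, (fun a => q (lft a)); split=> //.
- move=> t u Tt Tu; rewrite -{2}(lftE _ Tt) -{2}(lftE _ Tu) -linearB -qE linearB.
  by split=> [->|/subr0_eq//]; rewrite subrr.
- move=> DD Z sZ F k0 k1 k2 D1 D2 D12 y _ Zy.
  have appE m n (D : 'I_m -> 'I_n -> R) (a : 'I_n -> A) i : (forall j, Q (a j)) ->
      q (lft (app D a i)) = app D (fun j => q (lft (a j))) i.
    move=> Qa; rewrite -(app_linear q); congr (q _); apply: jinj.
    rewrite (app_linear j) lftE; last exact: appP.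
    by apply: eq_bigr => l _; rewrite lftE.
  have /choice[a aP] : forall k, exists a, Q a /\ q (lft a) = y k.
    by move=> k; have [a] := cs (y k); exists a.
  have Qa k : Q (a k) by case: (aP k).
  have ayE : (fun k => q (lft (a k))) = y by apply/funext => k; case: (aP k).
  have [//||x Qx e] := F _ _ _ _ _ D12 a.
    by move=> i; rewrite appE // ayE.
  exists (fun l => q (lft (x l))) => // k.
  rewrite -appE // -{1}ayE -linearB.
  have -> : lft (a k) - lft (app D1 x k) = lft (a k - app D1 x k).
    apply: jinj; rewrite linearB !lftE //; first exact: appP.
    by apply: submodB => //; exact: appP.
  exact: e.
Qed.
End Subquotient.

Section SmallObject.
Variables (R : pzRingType) (DD : pairs R).
Hypothesis DDc : forall k0 k1 k2 (D1 : 'I_k1 -> 'I_k0 -> R) (D2 : 'I_k2 -> 'I_k1 -> R),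
  DD D1 D2 -> forall i l, \sum_j D2 i j * D1 j l = 0.
Variables (L M : lmodType R).
Hypothesis FL : inF DD L.

(* A generator names a copy of L to be glued along a partial map
   N -> M + (copies of L indexed by previously formed generators). *)
Inductive gen := Gen (N : L -> Prop) (m : L -> M) (n : L -> nat)
  (gs : forall k, 'I_(n k) -> gen) (ls : forall k, 'I_(n k) -> L).

Local Notation T := (M * (gen -> L))%type.

Definition gdom (e : gen) : L -> Prop := let: Gen N _ _ _ _ := e in N.

Definition raw (e : gen) (k : L) : T :=
  let: Gen N m n gs ls := e in (m k, \sum_(j < n k) single (gs k j) (ls k j)).

Definition iota_ (e : gen) (l : L) : T := (0, single e l).

Fixpoint desc (e e' : gen) : Prop :=
  let: Gen N m n gs ls := e in
  exists k (j : 'I_(n k)), e' = gs k j \/ desc (gs k j) e'.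

Definition span (S : T -> Prop) (t : T) :=
  forall P, submod P -> (forall s, S s -> P s) -> P t.

(** Since [raw] is assembled from arbitrarily chosen representatives, it can only be asked to be
    linear modulo relations S imposed earlier. *)
Definition gcond (e : gen) (S : T -> Prop) :=
  [/\ submod (gdom e), relF DD (fun=> True) (gdom e) &
      forall r x y, gdom e x -> gdom e y ->
        span S (raw e (r *: x + y) - (r *: raw e x + raw e y))].

Definition grel (e : gen) (S : T -> Prop) (t : T) :=
  gcond e S /\ exists2 k, gdom e k & t = iota_ e k - raw e k.

(** Whether a subterm contributes its gluing relations depends on the relations below it. Passing
    these to [grel] as a parameter keeps the recursion structural. *)
Fixpoint below (e : gen) (t : T) : Prop :=
  let: Gen N m n gs ls := e in
  exists k (j : 'I_(n k)), below (gs k j) t \/ grel (gs k j) (below (gs k j)) t.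

Definition good e := gcond e (below e).
Definition own e t := grel e (below e) t.

Lemma belowE e t : below e t <-> exists2 e', desc e e' & own e' t.
Proof.
elim: e => N m n gs IH ls /=; split.
  move=> [k [j [/IH[e' d o]|o]]].
    by exists e' => //; exists k, j; right.
  by exists (gs k j) => //; exists k, j; left.
move=> [e' [k [j [->|d]]] o]; exists k, j; first by right.
by left; apply/IH; exists e'.
Qed.

Lemma desc_trans e e' e'' : desc e e' -> desc e' e'' -> desc e e''.
Proof.
elim: e => N m n gs IH ls /= [k [j [->|d]]] d'; exists k, j; right=> //.
exact: IH d'.
Qed.

Lemma desc_wf e : Acc (fun a b => desc b a) e.
Proof.
elim: e => N m n gs IH ls; constructor=> e' /= [k [j [->|d]]]; first exact: IH.
exact: Acc_inv (IH k j) _ d.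
Qed.

Definition dclosed (X : gen -> Prop) := forall e e', X e -> desc e e' -> X e'.

Definition addg (X : gen -> Prop) e e' := X e' \/ e' = e.

(** This replaces transfinite induction. A maximal set satisfying P contains every generator, by
    well-founded induction on subterms: one whose proper subterms are all present could otherwise be
    added. *)
Lemma dclosed_ind (P : set (set gen)) X0 :
  P X0 ->
  (forall F : set (set gen), (exists X, F X) -> (forall X, F X -> P X) ->
     total_on F subset -> P (fun t => exists2 X, F X & X t)) ->
  (forall X e, P X -> ~ X e -> (forall e', desc e e' -> X e') -> P (addg X e)) ->
  P setT.
Proof.
move=> P0 hF step; have [A PA mA] := Zorn_ne P0 hF.
suff -> : setT = A by [].
rewrite predeqE => e0; split=> // _; elim: (desc_wf e0) => {e0} e _ IH.
apply: contrapT => nAe; apply: (nAe); apply: mA (step A e PA nAe IH) _ _ _.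
  by move=> x; left.
by right.
Qed.

Lemma span_submod S : submod (span S).
Proof.
split=> [P sP _|r x y hx hy P sP h]; first exact: submod0.
by case: (sP) => _; apply; [exact: hx | exact: hy].
Qed.

Lemma span_in (S : T -> Prop) t : S t -> span S t.
Proof. by move=> St P _; apply. Qed.

Lemma span_mono (S S' : T -> Prop) t : (forall s, S s -> S' s) -> span S t -> span S' t.
Proof. by move=> SS' h; apply: h; [exact: span_submod | move=> s /SS'/span_in]. Qed.

(* T_X/N_X is the module obtained by gluing only the copies indexed by X. *)
Definition NX (X : gen -> Prop) := span (fun t => exists2 e, X e & own e t).
Definition TX (X : gen -> Prop) (t : T) := finsupp t.2 /\ forall e, ~ X e -> t.2 e = 0.

Lemma NX_submod X : submod (NX X). Proof. exact: span_submod. Qed.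
Hint Resolve NX_submod : core.

Lemma NX_mono (X Y : gen -> Prop) t : (forall e, X e -> Y e) -> NX X t -> NX Y t.
Proof. by move=> XY; apply: span_mono => s [e /XY Ye o]; exists e. Qed.

Lemma TX_submod X : submod (TX X).
Proof.
split; first by split=> //; exists [::].
move=> r x y [fx hx] [fy hy]; split.
  by case: (finsupp_submod gen L) => _; apply.
by move=> e Xe /=; rewrite addrfctE scalrfctE hx // hy // scaler0 addr0.
Qed.
Hint Resolve TX_submod : core.

Lemma TX_mono (X Y : gen -> Prop) t : (forall e, X e -> Y e) -> TX X t -> TX Y t.
Proof. by move=> XY [ft ht]; split=> // e Ye; apply: ht => /XY. Qed.

Lemma iota_TX X e l : X e -> TX X (iota_ e l).
Proof.
by move=> Xe; split=> [|e' ne] /=; [exact: single_supp | rewrite single_ne // => ee; apply: ne; rewrite ee].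
Qed.

Lemma raw_TX (X : gen -> Prop) e k : (forall e', desc e e' -> X e') -> TX X (raw e k).
Proof.
case: e => N m n gs ls h; split=> /=.
  by apply: submod_sum => [|j _]; [exact: finsupp_submod | exact: single_supp].
move=> e Xe; rewrite fct_sumE big1 // => j _; rewrite single_ne // => ee.
by apply: Xe; apply: h; exists k, j; left.
Qed.

Lemma iota_linear e : exists f : {linear L -> T}, forall l, f l = iota_ e l.
Proof.
apply: linear_ex => r x y; congr pair; first by rewrite /= scaler0 addr0.
by have [f fE] := @single_linear R gen L e; rewrite /= -!fE linearP.
Qed.

Lemma iotaD e r x y : iota_ e (r *: x + y) = r *: iota_ e x + iota_ e y.
Proof. by have [f fE] := iota_linear e; rewrite -!fE linearP. Qed.

Lemma own_TX (X : gen -> Prop) e t : dclosed X -> X e -> own e t -> TX X t.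
Proof.
move=> dX Xe [_ [k _ ->]]; apply: submodB => //; first exact: iota_TX.
by apply: raw_TX => e'; exact: dX.
Qed.

Lemma NX_TX X t : dclosed X -> NX X t -> TX X t.
Proof. by move=> dX; apply=> // s [e Xe]; exact: own_TX. Qed.

Lemma below_NX X e t : (forall e', desc e e' -> X e') -> span (below e) t -> NX X t.
Proof.
move=> h; apply: span_mono => s /belowE[e' d o]; exists e' => //; exact: h.
Qed.

Lemma dclosed_add X e : dclosed X -> (forall e', desc e e' -> X e') -> dclosed (addg X e).
Proof. by move=> dX h a b [Xa|->] ab; left; [exact: dX ab | exact: h]. Qed.

Lemma raw0_NX X e : (forall e', desc e e' -> X e') -> good e -> NX X (raw e 0).
Proof.
move=> h [sN _ lin]; have := lin 1 0 0 (submod0 sN) (submod0 sN).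
rewrite scaler0 addr0 scale1r opprD addrA subrr add0r => /(below_NX h) N0.
rewrite -[raw e 0]opprK; exact: (submodN (NX_submod X) N0).
Qed.

Lemma iota0 e : iota_ e 0 = 0.
Proof. by have [f fE] := iota_linear e; rewrite -fE linear0. Qed.

(** [raw] is linear modulo the relations of X, so the elements of the described shape form a
    submodule, and this contains all generating relations. *)
Lemma NX_good X e t : dclosed X -> (forall e', desc e e' -> X e') -> good e ->
  NX (addg X e) t -> exists2 k, gdom e k & NX X (t - (iota_ e k - raw e k)).
Proof.
move=> dX h [sN FN lin] Nt.
have raw0 := raw0_NX h (And3 sN FN lin).
have linX r x y : gdom e x -> gdom e y ->
    NX X (raw e (r *: x + y) - (r *: raw e x + raw e y)).
  by move=> hx hy; apply: (below_NX h); exact: lin.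
apply: (Nt (fun t => exists2 k, gdom e k & NX X (t - (iota_ e k - raw e k)))).
  split.
    exists 0; first exact: submod0.
    by rewrite iota0 !sub0r opprK.
  move=> r x y [k Nk hk] [l Nl hl]; exists (r *: k + l); first by case: sN => _; apply.
  have -> : r *: x + y - (iota_ e (r *: k + l) - raw e (r *: k + l))
    = (r *: (x - (iota_ e k - raw e k)) + (y - (iota_ e l - raw e l)))
       + (raw e (r *: k + l) - (r *: raw e k + raw e l)).
    rewrite iotaD !opprB scalerDr scalerBr.
    rewrite [r *: x + _ + (y + _)]addrACA [_ - _ + (raw e l - _)]addrACA -opprD.
    by rewrite -[RHS]addrA; congr (_ + _); rewrite [RHS]addrC addrA subrK.
  apply: (submodD (NX_submod X)); last exact: linX.
  by case: (NX_submod X) => _; apply.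
move=> s [e' [Xe'|->] o].
  exists 0; first exact: submod0.
  rewrite iota0 sub0r opprK.
  by apply: (submodD (NX_submod X)) => //; apply: span_in; exists e'.
by case: o => _ [k Nk ->]; exists k => //; rewrite subrr; exact: submod0.
Qed.

Lemma NX_bad X e t : ~ good e -> NX (addg X e) t -> NX X t.
Proof.
move=> bad; apply: span_mono => s [e' [Xe'|->] o]; first by exists e'.
by case: o => /bad.
Qed.

(** The coordinate at e detects the amount k of the new relation used. It vanishes on [TX X], so k =
    0, and only [raw e 0] is left, which is already a relation of X. *)
Lemma NX_step X e t : dclosed X -> ~ X e -> (forall e', desc e e' -> X e') ->
  NX (addg X e) t -> TX X t -> NX X t.
Proof.
move=> dX nXe h Nt [_ Tt].
have [ge|/NX_bad] := pselect (good e); last exact.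
have [k Nk hk] := NX_good dX h ge Nt.
have [_ /(_ e nXe) n0] := NX_TX dX hk; have [_ /(_ e nXe) r0] := raw_TX k h.
have : t.2 e - (single e k e - (raw e k).2 e) = 0 := n0.
rewrite Tt // r0 singleE sub0r subr0 => /eqP; rewrite oppr_eq0 => /eqP k0; subst k.
move: hk; rewrite iota0 sub0r opprK => hk.
by rewrite -[t](addrK (raw e 0)); apply: (submodB (NX_submod X)) => //; exact: raw0_NX.
Qed.

(** In other words, the gluing of X embeds into the full gluing. Starting from X, generators are
    added one at a time and [NX_step] is applied. *)
Lemma NX_cap X t : dclosed X -> NX setT t -> TX X t -> NX X t.
Proof.
move=> dX Nt Tt.
pose P (Y : set gen) := [/\ dclosed Y, forall e, X e -> Y e & NX Y t -> NX X t].
suff [_ _] : P setT by apply.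
apply: (@dclosed_ind P X) => //.
- move=> F [X0 FX0] FP tot; split.
  + by move=> e e' [Y FY Ye] d; exists Y => //; case: (FP _ FY) => dY _ _; exact: dY d.
  + by move=> e Xe; exists X0 => //; case: (FP _ FX0) => _ h _; exact: h.
  + move=> /(_ (fun s => exists2 Y, F Y & NX Y s))[||Y FY].
    * split; first by exists X0 => //; exact: submod0.
      move=> r x y [Y FY Yx] [Z FZ Zy]; have [YZ|ZY] := tot _ _ FY FZ.
        by exists Z => //; case: (NX_submod Z) => _; apply=> //; exact: NX_mono Yx.
      by exists Y => //; case: (NX_submod Y) => _; apply=> //; exact: NX_mono Zy.
    * by move=> s [e [Y FY Ye] o]; exists Y => //; apply: span_in; exists e.
    * by case: (FP _ FY).
- move=> Y e [dY XY IH] nYe h; split.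
  + exact: dclosed_add.
  + by move=> e' /XY; left.
  + by move=> N; apply: IH; apply: NX_step N _ => //; exact: TX_mono Tt.
Qed.


Lemma TX_chain (F : set (set gen)) t :
  total_on F subset -> (exists X, F X) ->
  TX (fun e => exists2 X, F X & X e) t -> exists2 X, F X & TX X t.
Proof.
move=> tot ne [[s hs] ht].
have [X FX hX] : exists2 X, F X & forall e, List.In e s -> (exists2 Y, F Y & Y e) -> X e.
  elim: s {hs} => [|a s [X FX hX]]; first by have [X FX] := ne; exists X.
  have [[Y FY Ya]|na] := pselect (exists2 Y, F Y & Y a); last first.
    by exists X => // e [<-|] //; exact: hX.
  have [XY|YX] := tot _ _ FX FY; [exists Y|exists X] => // e [<-|es] he //.
  - by apply: XY; exact: hX.
  - exact: YX.
  - exact: hX.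
exists X => //; split; first by exists s.
move=> e nXe; have [es|/hs //] := pselect (List.In e s).
by apply: ht => he; apply: nXe; exact: hX.
Qed.

(** The preimage in T of the image of [TX X] in the full gluing. These submodules form the
    filtration whose layers are studied next. *)
Definition UX X := addsub (TX X) (NX setT).

Lemma UX_submod X : submod (UX X).
Proof. exact: addsub_submod. Qed.

Lemma UX_mono (X Y : gen -> Prop) t : (forall e, X e -> Y e) -> UX X t -> UX Y t.
Proof. by move=> XY [a [b [Ta Nb ->]]]; exists a, b; split=> //; exact: TX_mono Ta. Qed.

(** The map [iota_ e] identifies this layer with L modulo [gdom e] when e is good. A bad e imposes
    no relation, and the layer is then L itself. *)
Lemma relF_UX_step X e : dclosed X -> ~ X e -> (forall e', desc e e' -> X e') ->
  relF DD (UX (addg X e)) (UX X).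
Proof.
move=> dX nXe h; have [f fE] := iota_linear e.
have sN := NX_submod setT.
pose P l := if pselect (good e) then gdom e l else l = 0.
(* [NX_cap] reduces the relation to one of X and e, whose coordinate at e determines l. *)
have key l t : TX X t -> NX setT (iota_ e l - t) -> P l.
  move=> Tt Nl.
  have {}Nl : NX (addg X e) (iota_ e l - t).
    apply: NX_cap => //; first exact: dclosed_add.
    apply: (submodB (TX_submod _)); first by apply: iota_TX; right.
    by apply: TX_mono Tt; left.
  rewrite /P; case: pselect => [ge|bad] /=.
    have [k Nk hk] := NX_good dX h ge Nl.
    have [_ /(_ e nXe) n0] := NX_TX dX hk; have [_ /(_ e nXe) r0] := raw_TX k h.
    have : (single e l e - t.2 e) - (single e k e - (raw e k).2 e) = 0 := n0.
    by case: Tt => _ ->; rewrite // r0 !singleE !subr0 => /subr0_eq ->.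
  have [_ /(_ e nXe) n0] := NX_TX dX (NX_bad bad Nl).
  have : single e l e - t.2 e = 0 := n0.
  by case: Tt => _ ->; rewrite // singleE subr0.
have FP : relF DD (fun=> True) P.
  by rewrite /P; case: pselect => [[? ? ?]|?] /=; [|exact: FL].
apply/(relF_transfer DD (h := f) (Q := fun=> True) (P := P)) => //.
- exact: UX_submod.
- move=> l _; rewrite fE; apply: addsubl => //.
  by apply: iota_TX; right.
- move=> _ [t [n [Tt Nn ->]]]; exists (t.2 e) => //; rewrite fE.
  exists (t - iota_ e (t.2 e)), n; split=> //; last by rewrite addrAC.
  have [ft _] : TX (addg X e) (t - iota_ e (t.2 e)).
    by apply: (submodB (TX_submod _)) => //; apply: iota_TX; right.
  split=> // e' nXe'.
  change (t.2 e' - single e (t.2 e) e' = 0).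
  have [->|ne] := pselect (e' = e); first by rewrite singleE subrr.
  by rewrite single_ne // subr0; case: Tt => _; apply; case.
- move=> l _; rewrite fE; split=> [|[t [n [Tt Nn E]]]]; last first.
    by apply: (key _ t) => //; rewrite E addrC addKr.
  rewrite /P; case: pselect => [ge|?] /= => [Nl|->]; last by rewrite iota0; exact: (submod0 (UX_submod _)).
  exists (raw e l), (iota_ e l - raw e l); split.
  + exact: raw_TX.
  + by apply: span_in; exists e => //; split=> //; exists l.
  + by rewrite addrC subrK.
Qed.

(** Induction along the filtration: [relF_ext] adds one layer and [relF_chain] handles unions. *)
Lemma relF_UX : relF DD (UX setT) (UX set0).
Proof.
pose P (Y : set gen) := dclosed Y /\ relF DD (UX Y) (UX set0).
suff [_] : P setT by [].
apply: (@dclosed_ind P set0).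
- by split=> //; apply: relF_refl; exact: UX_submod.
- move=> F ne FP tot; split.
    by move=> e e' [Y FY Ye] d; exists Y => //; case: (FP _ FY) => dY _; exact: dY d.
  pose F' (U : set T) := exists2 X, F X & U = UX X.
  have tot' : total_on F' subset.
    move=> _ _ [X FX ->] [Y FY ->]; have [XY|YX] := tot _ _ FX FY; [left|right].
      by move=> t; exact: UX_mono.
    by move=> t; exact: UX_mono.
  have := relF_chain (DD := DD) (P := UX set0) tot'.
  have -> : (fun a => exists2 X : set T, F' X & X a)
            = UX (fun t => exists2 X : set gen, F X & X t).
    rewrite predeqE => t; split.
      move=> [_ [X FX ->]]; apply: UX_mono => e Xe; by exists X.
    move=> [a [b [Ta Nb ->]]]; have [X FX Xa] := TX_chain tot ne Ta.
    by exists (UX X); [exists X | exists a, b].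
  apply; first by have [X FX] := ne; exists (UX X), X.
  by move=> _ [X FX ->]; case: (FP _ FX).
- move=> X e [dX IH] nXe h; split; first exact: dclosed_add.
  have s := UX_submod.
  apply: (relF_ext DDc (s set0) (s X) (s (addg X e))) => //.
  + by move=> t; exact: UX_mono.
  + by move=> t; apply: UX_mono; left.
  + exact: relF_UX_step.
Qed.

Lemma small_object :
  exists (B : lmodType R) (i : {linear M -> B}),
  [/\ injective i, relF DD (fun=> True) (fun b => exists m, i m = b) &
      forall N : L -> Prop, submod N -> relF DD (fun=> True) N -> ext_prop B N].
Proof.
have [B [q [qlin qs qE qF]]] := subquotient_ex (TX_submod setT) (NX_submod setT).
have TM m : TX setT (m, 0) by split=> //=; exists [::].
have q0 : q 0 = 0.
  have := qlin 1 0 0; rewrite scaler0 addr0 scale1r => /(_ (TM 0) (TM 0)) h.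
  by apply: (addrI (q 0)); rewrite addr0 -h.
have [i iE] : exists i : {linear M -> B}, forall m, i m = q (m, 0).
  apply: linear_ex => r x y; rewrite -qlin //; congr (q (_, _)).
  by rewrite /= scaler0 addr0.
exists B, i; split.
- apply: linear_inj0 => m; rewrite iE -q0 => /(qE _ _ (TM m) (TM 0)); rewrite subr0 => Nm.
  (* An element of M that is a relation is, by [NX_cap], a relation of the empty set of generators,
     hence zero. *)
  have N0 : NX set0 (m, 0) by apply: NX_cap => //; split=> //=; exists [::].
  have /(congr1 fst) // : (m, 0) = 0 :> T.
  by apply: (N0 (fun t => t = 0)); [exact: submod_eq0 | move=> s []].
- apply: qF; first exact: submod_image.
  have UE t : TX setT t -> (UX set0 t <-> exists m, i m = q t).
    move=> Tt; split=> [[s [n [[fs s0] Nn E]]]|[m]].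
      exists s.1; rewrite iE; apply/(qE _ _ (TM _) Tt).
      have -> : (s.1, 0) = s.
        by rewrite [RHS]surjective_pairing; congr pair; apply/funext => e; rewrite s0.
      by rewrite E opprD addrA subrr add0r; exact: (submodN (NX_submod _)).
    rewrite iE => /(qE _ _ (TM m) Tt) Nm.
    exists (m, 0), (t - (m, 0)); split; last by rewrite addrC subrK.
      by split=> //=; exists [::].
    by rewrite -opprB; exact: (submodN (NX_submod _)).
  move=> k0 k1 k2 D1 D2 D12 y Ty Zy.
  have UT t : UX setT t -> TX setT t.
    by move=> [s [n [Ts Nn ->]]]; apply: (submodD (TX_submod _)) => //; exact: NX_TX.
  have [||x Ux e] := relF_UX D12 (y := y).
  + by move=> j; apply: addsubl.
  + by move=> k; apply/UE => //; apply: appP.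
  exists x => [l|j]; first exact: UT.
  apply/UE; last exact: e.
  by apply: (submodB (TX_submod _)) => //; apply: appP => // l; exact: UT.
- move=> N sN FN th thl.
  (* Representatives of the values of th, written as an element of M plus a finite sum over
     generators, are exactly the data of a new generator e. *)
  have /choice[dt dtE] : forall k, exists d : M * {n : nat & ('I_n -> gen) * ('I_n -> L)}%type,
      q (d.1, \sum_(a < projT1 d.2) single ((projT2 d.2).1 a) ((projT2 d.2).2 a)) = th k.
    move=> k; have [t [ft _] <-] := qs (th k).
    have [n [e [l E]]] := finsupp_sum ft.
    by exists (t.1, existT _ n (e, l)); rewrite /= -E -surjective_pairing.
  pose e := Gen N (fun k => (dt k).1) (n := fun k => projT1 (dt k).2)
     (fun k => (projT2 (dt k).2).1) (fun k => (projT2 (dt k).2).2).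
  have rawE k : q (raw e k) = th k by exact: dtE.
  have rT k : TX setT (raw e k) by apply: raw_TX.
  have iT l : TX setT (iota_ e l) by apply: iota_TX.
  have ge : good e.
    split=> // r x y Nx Ny.
    (* Linearity of th makes this a relation of the full gluing. It is supported on the subterms of
       e, so [NX_cap] derives it from the relations below e, and e is good. *)
    have : NX (desc e) (raw e (r *: x + y) - (r *: raw e x + raw e y)).
      apply: NX_cap; first by move=> a b; exact: desc_trans.
        have Tl : TX setT (r *: raw e x + raw e y) by case: (TX_submod setT) => _; apply.
        by apply/(qE _ _ (rT _) Tl); rewrite qlin // !rawE thl.
      have rd k : TX (desc e) (raw e k) by exact: raw_TX.
      by apply: (submodB (TX_submod _)) => //; case: (TX_submod (desc e)) => _; apply.
    by apply: span_mono => s [e' d o]; apply/belowE; exists e'.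
  have [g gE] : exists g : {linear L -> B}, forall l, g l = q (iota_ e l).
    by apply: linear_ex => r x y; rewrite iotaD qlin.
  exists g => k Nk; rewrite gE -rawE; apply/(qE _ _ (iT _) (rT _)).
  by apply: span_in; exists e => //; split=> //; exists k.
Qed.
End SmallObject.

(** * Minimal weakly terminal objects *)

Lemma wo_ex (T : Type) : exists lt : T -> T -> Prop,
  [/\ well_founded lt, forall x y z, lt x y -> lt y z -> lt x z &
      forall x y, [\/ lt x y, x = y | lt y x]].
Proof.
have [Rr wo] := well_ordering_principle {classic T}.
have mn (A : T -> Prop) : (exists x, A x) ->
    exists2 z, A z & forall x, A x -> Rr z x.
  move=> [x Ax]; have [|z [[zA lb] _]] := wo (fun x => `[< A x >]).
    by exists x; apply/asboolP.
  by exists z; [exact/asboolP | move=> y Ay; apply: lb; exact/asboolP].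
have anti x y : Rr x y -> Rr y x -> x = y.
  move=> xy yx.
  have rf z : Rr z z by have [|_ -> h] := mn (fun t => t = z); [exists z | apply: h].
  have [|z [_ zu]] := wo (fun t => `[< t = x \/ t = y >]).
    by exists x; apply/asboolP; left.
  rewrite -(zu x) ?(zu y) //.
    by split=> [|t /asboolP[] ->] //; apply/asboolP; right.
  by split=> [|t /asboolP[] ->] //; apply/asboolP; left.
exists (fun x y => Rr x y /\ x <> y); split.
- move=> x; apply: contrapT => nx.
  have [|z nz mz] := mn (fun t => ~ Acc (fun x y => Rr x y /\ x <> y) t); first by exists x.
  apply: nz; constructor=> y [yz ne]; apply: contrapT => ny.
  by apply: ne; apply: anti => //; exact: mz.
- move=> x y z [xy nxy] [yz nyz].
  have [|m hm mm] := mn (fun t => [\/ t = x, t = y | t = z]); first by exists x; constructor.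
  have [mx my mz] : [/\ Rr m x, Rr m y & Rr m z] by split; apply: mm; constructor.
  case: hm => E; subst m.
  + by split=> // xz; apply: nxy; apply: anti => //; rewrite xz.
  + by case: nxy; exact: anti.
  + by case: nyz; exact: anti.
- move=> x y; have [->|ne] := pselect (x = y); first by constructor 2.
  have [|m hm mm] := mn (fun t => t = x \/ t = y); first by exists x; left.
  have [mx my] : Rr m x /\ Rr m y by split; apply: mm; [left|right].
  case: hm => E; subst m; [constructor 1 | constructor 3]; split=> //.
  by move=> yx; apply: ne.
Qed.

Lemma cantor (T : Type) (f : (T -> Prop) -> T) : ~ injective f.
Proof.
move=> inj; pose D t := exists2 A : T -> Prop, f A = t & ~ A t.
have nD : ~ D (f D) by move=> hD; case: (hD) => A /inj ->; apply.
by apply: (nD); exists D.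
Qed.

Section TwoSided.
Variables (R : pzRingType) (DD : pairs R).
Variables M1 M2 : lmodType R.

(* Objects M1 >-> A -> M2 with A/M1 in the class. Covers are the case M1 = 0
   and envelopes the case M2 = 0. *)
Definition obj (A : lmodType R) (i : M1 -> A) :=
  injective i /\ relF DD (fun=> True) (fun b => exists m, i m = b).

Definition mor (A B : lmodType R) (i : M1 -> A) (f : A -> M2) (i' : M1 -> B) (f' : B -> M2)
    (g : A -> B) := (forall m, g (i m) = i' m) /\ forall a, f' (g a) = f a.

Definition wterminal (G : lmodType R) (i : {linear M1 -> G}) (f : {linear G -> M2}) :=
  obj i /\ forall (A : lmodType R) (i' : {linear M1 -> A}) (f' : {linear A -> M2}),
    obj i' -> exists g : {linear A -> G}, mor i' f' i f g.

(** * Colimits of chains of endomorphisms of one object *)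

Section Colimit.
Variables (G : lmodType R) (i : {linear M1 -> G}) (f : {linear G -> M2}).
Hypothesis oG : obj i.
Variables (D : Type) (le : D -> D -> Prop) (S : D -> Prop) (d0 : D).
Variable u : D -> D -> {linear G -> G}.
Hypotheses (Sd0 : S d0)
  (le_refl : forall v, le v v)
  (le_trans : forall v w x, le v w -> le w x -> le v x)
  (le_total : forall v w, S v -> S w -> le v w \/ le w v)
  (endo_u : forall v w, S v -> S w -> le v w -> mor i f i f (u v w))
  (u_id : forall v x, S v -> u v v x = x)
  (u_comp : forall x v w a, S x -> S v -> S w -> le x v -> le v w ->
     u v w (u x v a) = u x w a).

Let eventually (C : D -> Prop) := exists2 v, S v & forall w, S w -> le v w -> C w.

Let ev2 (C C' : D -> Prop) : eventually C -> eventually C' ->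
  eventually (fun w => C w /\ C' w).
Proof.
move=> [v Sv hv] [w Sw hw]; have [vw|wv] := le_total Sv Sw.
  exists w => // x Sx wx; split; last exact: hw.
  by apply: hv => //; exact: le_trans wx.
exists v => // x Sx vx; split; first exact: hv.
by apply: hw => //; exact: le_trans vx.
Qed.

Let evI n (C : 'I_n -> D -> Prop) : (forall k, eventually (C k)) ->
  eventually (fun w => forall k, C k w).
Proof.
elim: n C => [|n IH] C h; first by exists d0 => // w _ _ [].
have [v Sv hv] := ev2 (h ord0) (IH (fun k => C (lift ord0 k)) (fun k => h _)).
exists v => // w Sw vw k; have [h0 h1] := hv w Sw vw.
by have [->//|] := eqVneq k ord0; rewrite eq_sym => /unlift_some[k' -> _].
Qed.

(* The colimit as germs at infinity of eventually coherent families. *)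
Let coh (phi : D -> G) v := S v /\ forall w, S w -> le v w -> phi w = u v w (phi v).
Let Q (phi : D -> G) := exists v, coh phi v.
Let P (phi : D -> G) := eventually (fun w => phi w = 0).

Let coh_le phi v w : coh phi v -> S w -> le v w -> coh phi w.
Proof.
move=> [Sv h] Sw vw; split=> // x Sx wx.
by rewrite h ?[phi w]h // ?u_comp //; exact: le_trans wx.
Qed.

Let coh_ev phi : Q phi -> eventually (coh phi).
Proof. by move=> [v hv]; exists v; [case: hv | move=> w Sw vw; exact: coh_le vw]. Qed.

Let sQ : submod Q.
Proof.
split; first by exists d0; split=> // w _ _; rewrite linear0.
move=> r x y Qx Qy; have [v Sv /(_ v Sv (le_refl v)) [[_ hx] [_ hy]]] := ev2 (coh_ev Qx) (coh_ev Qy).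
exists v; split=> // w Sw vw.
by rewrite addrfctE scalrfctE hx // hy // linearP.
Qed.

Let sP : submod P.
Proof.
split; first by exists d0.
move=> r x y Px Py; have [v Sv h] := ev2 Px Py; exists v => // w Sw vw.
by have [hx hy] := h w Sw vw; rewrite addrfctE scalrfctE hx hy scaler0 addr0.
Qed.

(** The element x of stage v, transported to all later stages; the value 0 elsewhere does not affect
    the germ. *)
Let germ v (x : G) : D -> G := fun w => if pselect (le v w) then u v w x else 0.

Let germE v x w : le v w -> germ v x w = u v w x.
Proof. by rewrite /germ; case: pselect. Qed.

Let germ_coh v x : S v -> coh (germ v x) v.
Proof. by move=> Sv; split=> // w Sw vw; rewrite !germE // u_id. Qed.

(** The colimit is again an object because finitely many germs can all be evaluated at one late
    stage, where the system is solved in G and the solution pushed to the colimit. *)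
Lemma colimit_ex : exists (C : lmodType R) (iC : {linear M1 -> C}) (fC : {linear C -> M2})
    (io : D -> {linear G -> C}),
  [/\ obj iC,
      forall v, S v -> mor i f iC fC (io v),
      forall v w x, S v -> S w -> le v w -> io w (u v w x) = io v x,
      forall c, exists v x, S v /\ io v x = c &
      forall v x, S v -> io v x = 0 -> exists w, [/\ S w, le v w & u v w x = 0]].
Proof.
have [C [c [cl cs cE cF]]] := subquotient_ex sQ sP.
have Qg v x : S v -> Q (germ v x) by move=> Sv; exists v; exact: germ_coh.
have /choice[io ioE] : forall v, exists g : {linear G -> C}, S v -> forall x, g x = c (germ v x).
  move=> v; have [Sv|nS] := pselect (S v); last first.
    have [g _] : exists g : {linear G -> C}, forall x, g x = 0.
      by apply: linear_ex => r x y; rewrite scaler0 addr0.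
    by exists g.
  have [g gE] : exists g : {linear G -> C}, forall x, g x = c (germ v x).
    apply: linear_ex => r x y; rewrite -cl; try exact: Qg.
    congr c; apply/funext => w; rewrite addrfctE scalrfctE /germ.
    by case: pselect => h /=; rewrite ?linearP // scaler0 addr0.
  by exists g.
have cg phi v : coh phi v -> c phi = io v (phi v).
  move=> h; have [Sv hv] := h; rewrite ioE //; apply/cE; [by exists v | exact: Qg |].
  by exists v => // w Sw vw; rewrite addrfctE opprfctE germE // hv // subrr.
have iou v w x : S v -> S w -> le v w -> io w (u v w x) = io v x.
  move=> Sv Sw vw; rewrite [RHS]ioE // -[u v w x](germE x vw) -cg //.
  exact: coh_le (germ_coh x Sv) Sw vw.
have ios x : exists v a, S v /\ io v a = x.
  have [phi [v hv] <-] := cs x; exists v, (phi v); split; last by rewrite -cg.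
  by case: hv.
have io0 v x : S v -> io v x = 0 -> exists w, [/\ S w, le v w & u v w x = 0].
  move=> Sv; rewrite -(linear0 (io v)) !ioE // => /cE h.
  have [//||w Sw hw] := h; [exact: Qg | exact: Qg |].
  have [z [Sz vz wz]] : exists z, [/\ S z, le v z & le w z].
    by have [?|?] := le_total Sv Sw; [exists w | exists v]; split.
  exists z; split=> //; have := hw z Sz wz.
  by rewrite addrfctE opprfctE !germE // linear0 subr0.
have [iC iCE] : exists g : {linear M1 -> C}, forall m, g m = io d0 (i m).
  by apply: linear_ex => r x y; rewrite !linearP.
have iCv v m : S v -> io v (i m) = iC m.
  move=> Sv; rewrite iCE.
  by have [h|h] := le_total Sd0 Sv; rewrite -(iou _ _ _ _ _ h) //; case: (endo_u _ _ h) => // ->.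
(* Elements with equal images agree at some later stage, and transition maps preserve f; so f
   descends to the colimit. *)
have io_f v w x y : S v -> S w -> io v x = io w y -> f x = f y.
  move=> Sv Sw e.
  have [z [Sz vz wz]] : exists z, [/\ S z, le v z & le w z].
    by have [?|?] := le_total Sv Sw; [exists w | exists v]; split.
  have /io0-/(_ Sz)[t [St zt]] : io z (u v z x - u w z y) = 0.
    by rewrite linearB !iou // e subrr.
  rewrite linearB !u_comp // => /subr0_eq E.
  rewrite -((endo_u Sv St (le_trans vz zt)).2 x) E.
  exact: (endo_u Sw St (le_trans wz zt)).2.
have /choice[fc fcE] : forall x, exists m, forall v a, S v -> io v a = x -> f a = m.
  move=> x; have [v [a [Sv e]]] := ios x; exists (f a) => w b Sw e'.
  by apply: (io_f w v) => //; rewrite e e'.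
have [fC fCE] : exists g : {linear C -> M2}, forall x, g x = fc x.
  apply: linear_ex => r x y.
  have [[v [a [Sv e]]] [w [b [Sw e']]]] := (ios x, ios y).
  have [z [Sz vz wz]] : exists z, [/\ S z, le v z & le w z].
    by have [?|?] := le_total Sv Sw; [exists w | exists v]; split.
  have ex : io z (u v z a) = x by rewrite iou.
  have ey : io z (u w z b) = y by rewrite iou.
  rewrite -(fcE _ _ _ Sz ex) -(fcE _ _ _ Sz ey) -linearP.
  by rewrite -(fcE (r *: x + y) z (r *: u v z a + u w z b)) // linearP ex ey.
exists C, iC, fC, io; split=> //; last first.
  by move=> v Sv; split=> [m|a]; [exact: iCv | rewrite fCE -(fcE _ v a)].
have [injG FG] := oG.
split.
  apply: linear_inj0 => m; rewrite iCE => /(io0 _ _ Sd0)[w [Sw dw]].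
  have [-> _] := endo_u Sd0 Sw dw.
  by rewrite -(linear0 i) => /injG.
apply: cF; first exact: submod_image.
move=> k0 k1 k2 D1 D2 D12 y Qy Zy.
have appE m n (E : 'I_m -> 'I_n -> R) (a : 'I_n -> D -> G) k t :
    app E a k t = app E (fun j => a j t) k.
  by rewrite /app fct_sumE.
have [v Sv hv] := evI (fun k => coh_ev (Qy k)).
(* An equality with an element of M1 in the colimit holds at all sufficiently late stages. *)
have [v' Sv' hv'] : eventually (fun w => forall k, exists m, i m = app D2 y k w).
  apply: evI => k; have [m e] := Zy k.
  have Qk : Q (app D2 y k) by exact: appP.
  have [a Sa ha] := coh_ev Qk.
  have : io a (app D2 y k a) = io a (i m) by rewrite iCv // e -cg //; exact: ha.
  move=> /eqP; rewrite -subr_eq0 -linearB => /eqP/(io0 _ _ Sa)[b [Sb ab]].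
  rewrite linearB; have [-> _] := endo_u Sa Sb ab.
  have [_ hb] := ha a Sa (le_refl a).
  rewrite -hb // => /subr0_eq eb.
  exists b => // w Sw bw; exists m.
  have [_ h] := coh_le (ha a Sa (le_refl a)) Sb ab.
  by rewrite h // eb; have [-> _] := endo_u Sb Sw bw.
have [z [Sz vz wz]] : exists z, [/\ S z, le v z & le v' z].
  by have [?|?] := le_total Sv Sv'; [exists v' | exists v]; split.
have [//||x _ hx] := FG _ _ _ _ _ D12 (fun j => y j z).
  by move=> k; rewrite -appE; exact: hv'.
exists (fun l => germ z (x l)) => [l|j]; first exact: Qg.
have [m em] := hx j; exists m.
have Qd : Q (y j - app D1 (fun l => germ z (x l)) j).
  by apply: submodB => //; apply: appP => // l; exact: Qg.
have cz : coh (y j - app D1 (fun l => germ z (x l)) j) z.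
  split=> // w Sw zw; rewrite !addrfctE !opprfctE !appE linearB (app_linear (u z w)).
  have [_ ->] := hv z Sz vz j => //; congr (_ - _).
  by apply: eq_bigr => l _; rewrite !germE // u_id.
rewrite (cg _ _ cz) -(iCv z) // em addrfctE opprfctE appE; congr (io z (_ - _)).
by apply: eq_bigr => l _; rewrite germE // u_id.
Qed.
End Colimit.

Lemma mor_comp (A B C : lmodType R) (iA : M1 -> A) (fA : A -> M2) (iB : M1 -> B)
    (fB : B -> M2) (iC : M1 -> C) (fC : C -> M2) (g : A -> B) (h : B -> C) :
  mor iA fA iB fB g -> mor iB fB iC fC h -> mor iA fA iC fC (h \o g).
Proof. by move=> [g1 g2] [h1 h2]; split=> x /=; rewrite ?g1 ?h1 ?h2 ?g2. Qed.

(** * Transfinite chains of copies of a weakly terminal object *)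

Section Rows.
Variables (G : lmodType R) (i : {linear M1 -> G}) (f : {linear G -> M2}).
Hypothesis wG : wterminal i f.
Local Notation En := {linear G -> G}.
Local Notation endo := (mor i f i f).
Variables (W : Type) (lt : W -> W -> Prop) (w0 : W).
Hypotheses (wf : well_founded lt)
  (lt_trans : forall x y z, lt x y -> lt y z -> lt x z)
  (lt_tri : forall x y, [\/ lt x y, x = y | lt y x])
  (w0P : forall w, w = w0 \/ lt w0 w).
Variable post : En -> En.
Hypothesis post_endo : forall g : En, endo g -> endo (post g).

(* [U v x] is the transition map from stage x to stage v; every stage is G. *)
Definition cocone (S : W -> Prop) (U : W -> W -> En) (t : W -> En) :=
  (forall v, S v -> endo (t v)) /\
  forall x v a, S x -> S v -> lt x v -> t v (U v x a) = t x a.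

(** All maps into stage v come from a cocone on the earlier stages followed by one further
    endomorphism. The latter may depend on the map from the first stage [w0]. *)
Definition row_ok (U : W -> W -> En) v := exists2 t, cocone (lt^~ v) U t &
  forall x a, lt x v -> U v x a = post (t w0) (t x a).

Lemma lt_irr x : ~ lt x x.
Proof. by elim: (wf x) => {}x _ IH h; exact: (IH x h h). Qed.

(** The stages in S form a chain whose colimit is an object; weak terminality maps it back to G, and
    composing with the colimit maps gives the cocone. *)
Lemma cocone_ex (S : W -> Prop) (U : W -> W -> En) :
  (forall v, S v -> row_ok U v) -> exists t, cocone S U t.
Proof.
move=> ok; have [[d Sd]|nS] := pselect (exists d, S d); last first.
  exists (fun=> (idfun : En)); split=> v; first by move=> Sv; case: nS; exists v.
  by move=> ? ? Sv; case: nS; exists v.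
have w0v v x : lt x v -> lt w0 v.
  by move=> xv; have [e|h] := w0P x; [rewrite -e | exact: lt_trans xv].
pose le v w := v = w \/ lt v w.
pose u v w : En := if pselect (v = w) then (idfun : En) else U w v.
have uE v x : u v v x = x by rewrite /u; case: pselect.
have uL v w : lt v w -> u v w = U w v.
  by rewrite /u; case: pselect => //= e vw; case: (@lt_irr v); rewrite {2}e.
have [||||||C [iC [fC [io [oC mio iou _ _]]]]] := @colimit_ex G i f wG.1 W le S d u Sd.
- by left.
- move=> v w x [->//|vw] [<-|wx]; right=> //; exact: lt_trans wx.
- move=> v w _ _; have [] := lt_tri v w; by [left; right | left; left | right; right].
- move=> v w Sv Sw [<-|vw]; first by split=> x; rewrite uE.
  have [t [te _] tE] := ok _ Sw.
  have [p1 p2] := post_endo (te _ (w0v _ _ vw)); have [t1 t2] := te _ vw.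
  by rewrite uL //; split=> x; rewrite tE // ?t1 ?p1 // p2 t2.
- by [].
- move=> x v w a Sx Sv Sw [<-|xv]; first by rewrite uE.
  move=> [<-|vw]; first by rewrite uE.
  have [t [te tc] tE] := ok _ Sw; have xw := lt_trans xv vw.
  by rewrite !uL // !tE // tc.
have [g mg] := wG.2 _ _ fC oC.
exists (fun v => (g \o io v : En)); split=> [v Sv|x v a Sx Sv xv].
  exact: mor_comp (mio _ Sv) mg.
by rewrite /= -[in RHS](iou x v) // ?uL //; right.
Qed.

Let step (C : (W -> En) -> Prop) : W -> En :=
  match pselect (exists t, C t) with
  | left h => fun v => (post (projT1 (cid h) w0) \o projT1 (cid h) v : En)
  | right _ => fun=> (idfun : En)
  end.

Let rowF w (prev : forall v, lt v w -> W -> En) : W -> En :=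
  step (cocone (lt^~ w) (fun v => match pselect (lt v w) with
                                  | left h => prev v h
                                  | right _ => fun=> (idfun : En)
                                  end)).

(** Well-founded recursion, choosing a cocone on the rows already built. The default identity in
    [step] is never reached, as [cocone_ex] shows in the induction. *)
Lemma rows_ex : exists U, forall w, row_ok U w.
Proof.
pose U := Fix wf _ rowF.
have UE w : U w = step (cocone (lt^~ w) U).
  rewrite /U Fix_eq; last first.
    move=> x h h' hh; congr (rowF _).
    by apply: functional_extensionality_dep => y; apply/funext => p; exact: hh.
  rewrite -/U /rowF; congr (step _); rewrite predeqE => t.
  have key x v : lt v w -> (match pselect (lt v w) with
      left h => U v | right _ => fun=> (idfun : En) end) x = U v x.
    by move=> vw; case: pselect.
  by split=> -[h1 h2]; split=> // x v a xw vw xv; move: (h2 x v a xw vw xv); rewrite key.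
exists U => w; elim: (wf w) => {}w _ IH.
have h := cocone_ex IH.
rewrite /row_ok UE /step; case: pselect => // h'.
by exists (projT1 (cid h')); first exact: (projT2 (cid h')).
Qed.
End Rows.

Lemma wo_min_ex (T : Type) (t : T) : exists (lt : T -> T -> Prop) (w0 : T),
  [/\ well_founded lt, forall x y z, lt x y -> lt y z -> lt x z,
      forall x y, [\/ lt x y, x = y | lt y x] & forall w, w = w0 \/ lt w0 w].
Proof.
have [lt [wf tr tri]] := wo_ex T.
suff [w0 h] : exists w0, forall w, ~ lt w w0.
  by exists lt, w0; split=> // w; have [/h//|->|] := tri w w0; [left|right].
elim: (wf t) => {}t _ IH; have [[w wt]|h] := pselect (exists w, lt w t); first exact: IH wt.
by exists t => w wt; apply: h; exists w.
Qed.

Section Minimal.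
Variables (G : lmodType R) (i : {linear M1 -> G}) (f : {linear G -> M2}).
Hypothesis wG : wterminal i f.
Local Notation En := {linear G -> G}.
Local Notation endo := (mor i f i f).

(** Otherwise [post] can always be chosen to kill something new, so each later stage kills an
    element of the first stage that survived at all intermediate ones. Choosing such elements is
    injective on stages. *)
Lemma stable_kernel_ex : exists2 b : En, endo b &
  forall u : En, endo u -> forall x, u (b x) = 0 -> b x = 0.
Proof.
apply: contrapT => nb.
have /choice[post pE] : forall b : En, exists u : En, endo b ->
    endo u /\ exists2 x, u (b x) = 0 & b x <> 0.
  move=> b; have [eb|neb] := pselect (endo b); last by exists b.
  apply: contrapT => nu; apply: nb; exists b => // u eu x ub0.
  by apply: contrapT => bx; apply: nu; exists u => _; split=> //; exists x.
(* The stages are the subsets of [option G], too many to inject into [option G]; [None] is reserved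
   for the first stage. *)
have [lt [w0 [wf tr tri w0P]]] := wo_min_ex (fun _ : option G => True).
have [|U ok] := rows_ex wG wf tr tri w0P (post := post).
  by move=> g /pE[].
have /choice[p hp] : forall w, exists x : option G, if x is Some x then
    lt w0 w /\ U w w0 x = 0 /\ forall v, lt w0 v -> lt v w -> U v w0 x <> 0
    else w = w0.
  move=> w; have [->|w0w] := w0P w; first by exists None.
  have [t [te tc] tE] := ok w; have [_ [x x1 x2]] := pE _ (te _ w0w).
  exists (Some x); split=> //; split; first by rewrite tE.
  by move=> v w0v vw U0; apply: x2; rewrite -(tc _ v) // U0 linear0.
have sep v w : lt v w -> p v <> p w.
  move=> vw e; have := hp w; have := hp v; rewrite e; case: (p w) => [x|].
    by move=> [w0v [U0 _]] [_ [_ h]]; exact: h U0.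
  by move=> ev ew; move: vw; rewrite ev ew => /(lt_irr wf).
apply: (@cantor _ p) => v w e.
by have [/sep|//|/sep] := tri v w; rewrite e.
Qed.
End Minimal.

(** Take the colimit of G under iteration of a stable b. Every element of it comes from some b a,
    and an endomorphism killing it yields, after a map back to G, an endomorphism of G killing b
    a. *)
Lemma injective_endo_ex (G : lmodType R) (i : {linear M1 -> G}) (f : {linear G -> M2}) :
  wterminal i f ->
  exists (H : lmodType R) (j : {linear M1 -> H}) (k : {linear H -> M2}),
    wterminal j k /\ forall g : {linear H -> H}, mor j k j k g -> injective g.
Proof.
move=> wG; have [b eb bs] := stable_kernel_ex wG.
pose u n m : {linear G -> G} := iter (m - n) (fun g : {linear G -> G} => (b \o g : {linear G -> G})) (idfun : {linear G -> G}).
have uE n m x : u n m x = iter (m - n) b x by rewrite /u; elim: (m - n)%N => //= k ->.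
have [||||||C [j [k [io [oC mio iou ios io0]]]]] :=
  @colimit_ex G i f wG.1 nat (fun n m => (n <= m)%N) (fun=> True) 0%N u I.
- by [].
- by move=> v w x vw wx; exact: leq_trans wx.
- by move=> v w _ _; case/orP: (leq_total v w); [left|right].
- move=> v w _ _ _; split=> x; rewrite uE; elim: (w - v)%N => //= m IH.
    by rewrite IH; case: eb.
  by case: eb => _ ->.
- by move=> v x _; rewrite uE subnn.
- move=> x v w a _ _ _ xv vw; rewrite !uE -iterD; congr (iter _ _ _).
  by rewrite addnBA // subnK.
have wC : wterminal j k.
  split=> // A i' f' oA; have [g mg] := wG.2 A i' f' oA.
  by exists (io 0%N \o g : {linear A -> C}); exact: mor_comp mg (mio _ I).
exists C, j, k; split=> // h mh; apply: linear_inj0 => c hc.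
have [n [a [_ ec]]] := ios c.
have [ka mka] := wG.2 _ _ k oC.
have eS : io n.+1 (b a) = c by rewrite -ec -(iou n n.+1) // uE subSnn.
rewrite -eS (bs (ka \o (h \o io n.+1) : {linear G -> G})) ?linear0 //.
  exact: mor_comp (mor_comp (mio _ I) mh) mka.
by rewrite /= eS hc linear0.
Qed.

(** If y is missed by the injective endomorphism g, take a chain all of whose transitions end with
    g. Injectivity of the cocone maps makes the images of y at different stages distinct, and there
    are too many stages. *)
Theorem minimal_wterminal (G : lmodType R) (i : {linear M1 -> G}) (f : {linear G -> M2}) :
  wterminal i f ->
  exists (H : lmodType R) (j : {linear M1 -> H}) (k : {linear H -> M2}),
    wterminal j k /\ forall g : {linear H -> H}, mor j k j k g -> bijective g.
Proof.
move=> /injective_endo_ex[H [j [k [wH inj]]]]; exists H, j, k; split=> // g eg.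
have injg := inj g eg.
suff /choice[g' g'K] : forall y, exists x, g x = y.
  by exists g' => x //; apply: injg; rewrite g'K.
move=> y; apply: contrapT => ny.
have [lt [w0 [wf tr tri w0P]]] := wo_min_ex (fun _ : H => True).
have [|U ok] := rows_ex wH wf tr tri w0P (post := fun=> g); first by [].
have [t [te tc]] := cocone_ex wH wf tr tri w0P (post := fun=> g) (fun _ _ => eg)
  (S := fun=> True) (U := U) (fun v _ => ok v).
have sep v w : lt v w -> t v y <> t w y.
  move=> vw; rewrite -(tc _ w) // => /(inj _ (te w I)).
  by have [s _ ->] := ok w => // E; apply: ny; exists (s v y).
apply: (@cantor _ (fun w => t w y)) => v w e.
by have [/sep|//|/sep] := tri v w; rewrite e.
Qed.
End TwoSided.

(** * Extensions and presentations *)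

Section Extensions.
Variable R : pzRingType.
Implicit Types A B C D M N S : lmodType R.

Lemma factor_ex A S B (p : {linear A -> S}) (h : {linear A -> B}) :
  surj p -> (forall a, p a = 0 -> h a = 0) ->
  exists g : {linear S -> B}, forall a, g (p a) = h a.
Proof.
move=> ps k.
have hE a b : p a = p b -> h a = h b.
  by move=> e; apply/subr0_eq; rewrite -linearB k // linearB e subrr.
have /choice[s sE] := ps.
have [g gE] : exists g : {linear S -> B}, forall x, g x = h (s x).
  by apply: linear_ex => r x y; rewrite -linearP; apply: hE; rewrite linearP !sE.
by exists g => a; rewrite gE; apply: hE; rewrite sE.
Qed.

(** A splitting of the pullback of the extension along h is a lift of h. *)
Lemma Ext1_lift A B D M (p : {linear A -> M}) (j : {linear B -> A}) (h : {linear D -> M}) :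
  surj p -> injective j -> exact_at j p -> Ext1_zero D B ->
  exists g : {linear D -> A}, forall d, p (g d) = h d.
Proof.
move=> ps ji ex DB.
have sP : submod (fun x : D * A => h x.1 = p x.2).
  split=> /= [|r x y hx hy]; first by rewrite !linear0.
  by rewrite /= !linearP hx hy.
have [S [io [ioi ioE]]] := sub_ex sP.
have pj b : p (j b) = 0 by apply/ex; exists b.
have /choice[b' b'E] : forall b, exists s, io s = (0, j b).
  by move=> b; apply/ioE; rewrite /= linear0 pj.
have [bl blE] : exists g : {linear B -> S}, forall b, g b = b' b.
  apply: linear_ex => r x y; apply: ioi; rewrite linearP !b'E linearP.
  by congr pair; rewrite /= scaler0 addr0.
have [q qE] : exists g : {linear S -> D}, forall s, g s = (io s).1.
  by apply: linear_ex => r x y; rewrite linearP.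
have [|||s sE] := DB S bl q.
- by move=> x y; rewrite !blE => /(congr1 io); rewrite !b'E => -[/ji].
- move=> d; have [a ea] := ps (h d).
  have /ioE[s es] : h (d, a).1 = p (d, a).2 by rewrite /= ea.
  by exists s; rewrite qE es.
- move=> s; rewrite qE; split=> [e|[b <-]]; last by rewrite blE b'E.
  have : h (io s).1 = p (io s).2 by apply/ioE; exists s.
  rewrite e linear0 => /esym/ex[b eb]; exists b; apply: ioi.
  by rewrite blE b'E [RHS]surjective_pairing e eb.
have [g gE] : exists g : {linear D -> A}, forall d, g d = (io (s d)).2.
  by apply: linear_ex => r x y; rewrite !linearP.
exists g => d; rewrite gE -[in RHS](sE d) qE; apply/esym/ioE; by exists (s d).
Qed.

(** Dually, the pushout along h is a split extension of C by B; subtracting the section leaves a map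
    into B that extends h. *)
Lemma Ext1_extend B C M N (i : {linear M -> N}) (p : {linear N -> C}) (h : {linear M -> B}) :
  injective i -> surj p -> exact_at i p -> Ext1_zero C B ->
  exists g : {linear N -> B}, forall m, g (i m) = h m.
Proof.
move=> ii ps ex CB.
pose P (x : N * B) := exists m, x = (i m, - h m).
have sP : submod P.
  split; first by exists 0; rewrite !linear0.
  move=> r _ _ [m ->] [m' ->]; exists (r *: m + m').
  rewrite (linearP i) (linearP h); congr pair => /=.
  by rewrite opprD scalerN.
have [E [q [qs qE]]] := quo_ex sP.
have [bl blE] : exists g : {linear B -> E}, forall b, g b = q (0, b).
  apply: linear_ex => r x y; rewrite -linearP; congr (q _).
  by congr pair; rewrite /= scaler0 addr0.
have [p1 p1E] : exists g : {linear (N * B)%type -> C}, forall x, g x = p x.1.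
  by apply: linear_ex => r x y; rewrite -linearP.
have pi m : p (i m) = 0 by apply/ex; exists m.
have [|pe peE] := factor_ex qs (h := p1).
  by move=> x /qE[m ->]; rewrite p1E /= pi.
have bli : injective bl.
  apply: linear_inj0 => b; rewrite blE => /qE[m [em ->]].
  have -> : m = 0 by apply: ii; rewrite linear0.
  by rewrite linear0 oppr0.
have gl m b : q (i m, b) = bl (b + h m).
  rewrite blE; apply/subr0_eq; rewrite -linearB; apply/qE; exists m.
  by congr pair => /=; rewrite ?subr0 // opprD addrA subrr add0r.
have exE x : pe x = 0 <-> exists b, bl b = x.
  split=> [|[b <-]]; last by rewrite blE peE p1E linear0.
  have [[n b] <-] := qs x; rewrite peE p1E /= => /ex[m <-].
  by exists (b + h m); rewrite gl.
have [|s sE] := CB E bl pe bli _ exE.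
  by move=> c; have [n <-] := ps c; exists (q (n, 0)); rewrite peE p1E.
have /choice[g gE] : forall n, exists b, bl b = q (n, 0) - s (p n).
  by move=> n; apply/exE; rewrite linearB sE peE p1E subrr.
have [g' g'E] : exists g' : {linear N -> B}, forall n, g' n = g n.
  apply: linear_ex => r x y; apply: bli; rewrite (linearP bl) !gE (linearP p) (linearP s).
  rewrite scalerBr addrACA -opprD; congr (_ - _).
  rewrite -linearP; congr (q _); by congr pair; rewrite /= scaler0 addr0.
exists g' => m; rewrite g'E; apply: bli; rewrite gE pi linear0 subr0 gl.
by rewrite add0r.
Qed.
End Extensions.

(** * Ext computed from a finite presentation *)

Section Presentations.
Variable R : pzRingType.
Implicit Types A N : lmodType R.

Lemma row_linear_ex A k (y : 'I_k -> A) :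
  exists h : {linear 'rV[R]_k -> A}, forall j, h (delta_mx 0 j) = y j.
Proof.
have [h hE] : exists h : {linear 'rV[R]_k -> A}, forall v, h v = \sum_j v 0 j *: y j.
  apply: linear_ex => r u v; rewrite scaler_sumr -big_split; apply: eq_bigr => j _.
  by rewrite !mxE scalerDl scalerA.
exists h => j; rewrite hE (bigD1 j) //= mxE !eqxx scale1r big1 ?addr0 // => l lj.
by rewrite mxE (negPf lj) andbF scale0r.
Qed.

Lemma row_linearE A k (h : {linear 'rV[R]_k -> A}) v :
  h v = \sum_j v 0 j *: h (delta_mx 0 j).
Proof.
by rewrite [v in LHS]row_sum_delta linear_sum; apply: eq_bigr => j _; rewrite linearZ.
Qed.

Lemma row_linear_eq A k (h g : {linear 'rV[R]_k -> A}) :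
  (forall j, h (delta_mx 0 j) = g (delta_mx 0 j)) -> forall v, h v = g v.
Proof.
by move=> e v; rewrite (row_linearE h) (row_linearE g); apply: eq_bigr => j _; rewrite e.
Qed.

(** Rows are images of basis vectors. With families in N read as maps from a free module to N,
    [app (mx_of d)] is precomposition with d. *)
Definition mx_of k l (d : 'rV[R]_k -> 'rV[R]_l) : 'I_k -> 'I_l -> R :=
  fun j l => d (delta_mx 0 j) 0 l.

Lemma app_mx_of A k l (d : 'rV[R]_k -> 'rV[R]_l) (h : {linear 'rV[R]_l -> A}) j :
  app (mx_of d) (fun m => h (delta_mx 0 m)) j = h (d (delta_mx 0 j)).
Proof. by rewrite [RHS]row_linearE. Qed.

Definition presentation A k0 k1 k2 (e : {linear 'rV[R]_k0 -> A})
    (d0 : {linear 'rV[R]_k1 -> 'rV[R]_k0}) (d1 : {linear 'rV[R]_k2 -> 'rV[R]_k1}) :=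
  [/\ surj e, exact_at d0 e & exact_at d1 d0].

(** The first Ext group is the cohomology at the middle term of Hom from the presentation into N. *)
Lemma Ext1_exact A N k0 k1 k2 (e : {linear 'rV[R]_k0 -> A})
    (d0 : {linear 'rV[R]_k1 -> 'rV[R]_k0}) (d1 : {linear 'rV[R]_k2 -> 'rV[R]_k1}) :
  presentation e d0 d1 ->
  (Ext1_zero A N <-> forall y : 'I_k1 -> N, (forall i, app (mx_of d1) y i = 0) ->
     exists x, forall j, y j = app (mx_of d0) x j).
Proof.
move=> [es ex0 ex1]; split=> [AN y y0|H E i p ii ps ex].
  have [Y Yd] := row_linear_ex y.
  have yE : y = fun j => Y (delta_mx 0 j) by apply/funext => j; rewrite Yd.
  have Y0 w : d0 w = 0 -> Y w = 0.
    move=> /ex1[z <-].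
    have [Yd1 Yd1E] : exists g : {linear 'rV[R]_k2 -> N}, forall v, g v = Y (d1 v).
      by apply: linear_ex => r u v; rewrite !linearP.
    rewrite -Yd1E row_linearE big1 // => l _; rewrite Yd1E -app_mx_of -yE y0.
    by rewrite scaler0.
  (* A cocycle factors through the image K of [d0], and extends from K to the free module because
     the cokernel is A. *)
  have [K [io [ioi ioE]]] := sub_ex (submod_image d0).
  have [d0' d0'E] : exists g : {linear 'rV[R]_k1 -> K}, forall w, io (g w) = d0 w.
    have /choice[g gE] : forall w, exists s, io s = d0 w by move=> w; apply/ioE; exists w.
    have [g' g'E] : exists g' : {linear 'rV[R]_k1 -> K}, forall w, g' w = g w.
      by apply: linear_ex => r u v; apply: ioi; rewrite linearP !gE linearP.
    by exists g' => w; rewrite g'E.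
  have [||h hE] := factor_ex (p := d0') (h := Y).
  - move=> s; have /ioE[w ew] : exists t, io t = io s by exists s.
    by exists w; apply: ioi; rewrite d0'E.
  - by move=> w e0; apply: Y0; rewrite -d0'E e0 linear0.
  have [|g gE] := Ext1_extend h ioi es _ AN.
    by move=> v; split=> [/ex0/ioE|/ioE/ex0].
  exists (fun l => g (delta_mx 0 l)) => j.
  by rewrite app_mx_of -d0'E gE hE Yd.
(* Lift the presentation map e to [ph] with values in E. On the image of [d0] it takes values in N,
   which gives a cocycle. *)
have /choice[ph0 ph0E] : forall l, exists x, p x = e (delta_mx 0 l) by move=> l; apply: ps.
have [ph phd] := row_linear_ex ph0.
have [pph pphE] : exists g : {linear 'rV[R]_k0 -> A}, forall v, g v = p (ph v).
  by apply: linear_ex => r u v; rewrite !linearP.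
have pe v : p (ph v) = e v.
  by rewrite -pphE; apply: row_linear_eq => l; rewrite pphE phd.
have /choice[y yE] : forall j, exists n, i n = ph (d0 (delta_mx 0 j)).
  by move=> j; apply/ex; rewrite pe; apply/ex0; exists (delta_mx 0 j).
have [phd0 phd0E] : exists g : {linear 'rV[R]_k1 -> E}, forall v, g v = ph (d0 v).
  by apply: linear_ex => r u v; rewrite !linearP.
have [|x xE] := H y.
  move=> k; apply: ii; rewrite (app_linear i) linear0.
  have -> : (fun j => i (y j)) = (fun j => phd0 (delta_mx 0 j)).
    by apply/funext => j; rewrite yE phd0E.
  rewrite app_mx_of phd0E; have -> : d0 (d1 (delta_mx 0 k)) = 0.
    by apply/ex1; exists (delta_mx 0 k).
  by rewrite linear0.
have [X Xd] := row_linear_ex x.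
have xE' : x = fun l => X (delta_mx 0 l) by apply/funext => l; rewrite Xd.
(* Correcting the lift by a cochain x bounding the cocycle makes it vanish on relations, so it
   descends to a section. *)
have [psi psiE] : exists g : {linear 'rV[R]_k0 -> E}, forall v, g v = ph v - i (X v).
  by apply: linear_ex => r u v; rewrite (linearP ph) (linearP X) (linearP i) scalerBr opprD addrACA.
have [psid psidE] : exists g : {linear 'rV[R]_k1 -> E}, forall v, g v = psi (d0 v).
  by apply: linear_ex => r u v; rewrite !linearP.
have [|s sE] := factor_ex es (h := psi).
  move=> v /ex0[w <-]; rewrite -psidE row_linearE big1 // => j _.
  by rewrite psidE psiE -yE xE xE' app_mx_of subrr scaler0.
exists s => a; have [v <-] := es a.
by rewrite sE psiE linearB pe; have -> : p (i (X v)) = 0 by [apply/ex; exists (X v)]; rewrite subr0.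
Qed.
End Presentations.

(** * Perfect cotorsion pairs *)

Section Complete.
Variables (R : pzRingType) (DD : pairs R).
Hypothesis DDc : forall k0 k1 k2 (D1 : 'I_k1 -> 'I_k0 -> R) (D2 : 'I_k2 -> 'I_k1 -> R),
  DD D1 D2 -> forall i l, \sum_j D2 i j * D1 j l = 0.
Hypothesis FR : inF DD (R^o : lmodType R).
Implicit Types A B M : lmodType R.

(** The free module on [trm R] serves as the single test module for both Eklof's lemma and the small
    object argument. *)
Lemma special_preenvelope M : exists B (i : {linear M -> B}),
  [/\ injective i, relF DD (fun=> True) (fun b => exists m, i m = b) &
      rperp (inF DD) B].
Proof.
have [L [d [FL dfree]]] := free_ex (trm R) FR.
have [B [i [ii Fi ext]]] := small_object DDc M FL.
by exists B, i; split=> // A; exact: (eklof dfree ext).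
Qed.

(** Salce's construction: embed the kernel K of a free cover L of M into some B by the preenvelope,
    and let A be the pushout of L and B over K. *)
Lemma special_precover M : exists A B (p : {linear A -> M}) (j : {linear B -> A}),
  [/\ surj p, injective j, exact_at j p, inF DD A & rperp (inF DD) B].
Proof.
have [L [d [FL dfree]]] := free_ex M FR.
have [g gE] := dfree.1 _ id.
have gs : surj g by move=> m; exists (d m); rewrite gE.
have [K [ka [kai kaE]]] := sub_ex (submod_ker g).
have [B [i [ii Fi pB]]] := special_preenvelope K.
pose P (x : L * B) := exists k, x = (ka k, - i k).
have sP : submod P.
  split; first by exists 0; rewrite !linear0.
  move=> r _ _ [m ->] [m' ->]; exists (r *: m + m').
  rewrite (linearP i) (linearP ka); congr pair => /=.
  by rewrite opprD scalerN.
have [A [q [qs qE]]] := quo_ex sP.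
have [j jE] : exists j : {linear B -> A}, forall b, j b = q (0, b).
  apply: linear_ex => r x y; rewrite -linearP; congr (q _).
  by congr pair; rewrite /= scaler0 addr0.
have [p1 p1E] : exists p1 : {linear (L * B)%type -> M}, forall x, p1 x = g x.1.
  by apply: linear_ex => r x y; rewrite -linearP.
have gk k : g (ka k) = 0 by apply/kaE; exists k.
have [|p pE] := factor_ex qs (h := p1).
  by move=> x /qE[k ->]; rewrite p1E /= gk.
exists A, B, p, j; split=> //.
- by move=> m; have [l <-] := gs m; exists (q (l, 0)); rewrite pE p1E.
- apply: linear_inj0 => b; rewrite jE => /qE[k [ek ->]].
  have -> : k = 0 by apply: kai; rewrite linear0.
  by rewrite linear0 oppr0.
- move=> a; split=> [|[b <-]]; last by rewrite jE pE p1E linear0.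
  have [[l b] <-] := qs a; rewrite pE p1E /= => /kaE[k <-].
  exists (b + i k); rewrite jE; apply/esym/subr0_eq; rewrite -linearB; apply/qE; exists k.
  by congr pair => /=; rewrite ?subr0 // opprD addrA subrr add0r.
(* Q lies between P and L x B, with Q/P isomorphic to L and the upper layer to B/K; both are in the
   class. *)
pose Q (x : L * B) := exists k, i k = x.2.
have sQ : submod Q.
  split; first by exists 0; rewrite linear0.
  by move=> r x y [k ek] [l el]; exists (r *: k + l); rewrite linearP ek el.
apply/(inF_quo DD qs qE); apply: (relF_ext DDc sP sQ (@submodT _ _)) => //.
- by move=> _ [k ->]; exists (- k); rewrite linearN.
- have [f fE] : exists f : {linear L -> (L * B)%type}, forall l, f l = (l, 0).
    by apply: linear_ex => r x y; congr pair; rewrite /= scaler0 addr0.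
  apply/(relF_transfer DD (h := f) (Q := fun=> True) (P := fun l => l = 0)) => //.
  + by move=> l _; exists 0; rewrite fE linear0.
  + move=> [l b] [k ek]; exists (l + ka k) => //; exists (- k).
    rewrite fE !linearN opprK ek; congr pair => /=; last by rewrite subr0.
    by rewrite opprD addrA subrr add0r.
  + move=> l _; rewrite fE; split=> [->|[k [-> /eqP]]].
      by exists 0; rewrite !linear0.
    rewrite eq_sym oppr_eq0 => /eqP ik.
    have -> : k = 0 by apply: ii; rewrite linear0.
    by rewrite linear0.
- have [f fE] : exists f : {linear (L * B)%type -> B}, forall x, f x = x.2.
    by apply: linear_ex.
  apply/(relF_transfer DD (h := f) (Q' := fun=> True) (P' := fun b => exists m, i m = b)) => //.
  + exact: submod_image.
  + by move=> b _; exists (0, b) => //; rewrite fE subrr; exists 0; rewrite linear0.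
  + by move=> x _; rewrite fE.
Qed.

(** A module in the left orthogonal splits its own special precover, and the class is closed under
    direct summands. *)
Lemma cotorsion_inF : cotorsion_pair (inF DD) (rperp (inF DD)).
Proof.
split=> // X; split=> [lX|FX B pB]; last exact: pB.
have [A [B [p [j [ps ji ex FA pB]]]]] := special_precover X.
have [s sE] := lX B pB A j p ji ps ex.
exact: inF_retract sE FA.
Qed.

Let zero_linear A B : exists f : {linear A -> B}, forall x, f x = 0.
Proof. by apply: linear_ex => r x y; rewrite scaler0 addr0. Qed.

Lemma covering_inF : covering (inF DD).
Proof.
move=> M; have [A [B [p [j [ps ji ex FA pB]]]]] := special_precover M.
pose O := 'rV[R]_0 : lmodType R.
have objE A' (i : {linear O -> A'}) : obj DD i <-> inF DD A'.
  have -> : inF DD A' = relF DD (fun=> True) (fun b => exists m, i m = b).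
    congr relF; rewrite predeqE => b; split=> [->|[m <-]].
      by exists 0; rewrite linear0.
    by rewrite (thinmx0 m) linear0.
  split=> [[]//|F]; split=> // x y _; by rewrite (thinmx0 x) (thinmx0 y).
have [i _] := zero_linear O A.
have wA : wterminal DD i p.
  split; first exact/objE.
  move=> A' i' f' /objE FA'.
  have [g gE] := Ext1_lift f' ps ji ex (pB _ FA').
  by exists g; split=> // m; rewrite (thinmx0 m) !linear0.
have [H [i' [k [[oH wH] bij]]]] := minimal_wterminal wA.
exists H, k; split.
- exact/(objE H i').
- move=> D' FD' h; have [i'' _] := zero_linear O D'.
  have [g [_ gE]] := wH _ i'' h ((objE D' i'').2 FD').
  by exists g.
- move=> g gE; apply: bij; split=> // m; by rewrite (thinmx0 m) !linear0.
Qed.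

Lemma quotient_inF_ext A M B (i : {linear M -> A}) (h : {linear M -> B}) :
  injective i -> relF DD (fun=> True) (fun a => exists m, i m = a) ->
  rperp (inF DD) B -> exists g : {linear A -> B}, forall m, g (i m) = h m.
Proof.
move=> ii Fi pB; have [C [p [ps pE]]] := quo_ex (submod_image i).
by apply: (Ext1_extend h ii ps pE); apply: pB; apply/(inF_quo DD ps pE).
Qed.

(** Minimality also puts H in the right orthogonal. In an extension E of A by H, E is again an
    object, so it maps back to H; restricted to H this is an endomorphism, hence bijective, and the
    extension splits. *)
Lemma enveloping_inF : enveloping (rperp (inF DD)).
Proof.
move=> M; have [B [i [ii Fi pB]]] := special_preenvelope M.
pose O := 'rV[R]_0 : lmodType R.
have O0 (x y : O) : x = y by rewrite (thinmx0 x) (thinmx0 y).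
have [f _] := zero_linear B O.
have wB : wterminal DD i f.
  split=> // A i' f' [ii' Fi'].
  have [g gE] := quotient_inF_ext i ii' Fi' pB.
  by exists g; split.
have [H [j [k [[[ji Fj] wH] bij]]]] := minimal_wterminal wB.
exists H, j; split; last first.
- by move=> g gE; apply: bij; split.
- by move=> D' pD' h; exact: quotient_inF_ext.
move=> A FA E e p ei ps ex.
have [ej ejE] : exists ej : {linear M -> E}, forall m, ej m = e (j m).
  by apply: linear_ex => r x y; rewrite !linearP.
have [fE _] := zero_linear E O.
have oE : obj DD ej.
  split; first by move=> x y; rewrite !ejE => /ei/ji.
  have sej := submod_image ej; have se := submod_image e.
  apply: (relF_ext DDc sej se (@submodT _ _)) => //.
  - by move=> _ [m <-]; exists (j m); rewrite ejE.
  - apply/(relF_transfer DD (h := e) (Q := fun=> True) (P := fun b => exists m, j m = b)) => //.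
    + by move=> x _; exists x.
    + by move=> _ [x <-]; exists x => //; rewrite subrr; exists 0; rewrite linear0.
    + move=> x _; split=> -[m em]; exists m; first by rewrite ejE em.
      by apply: ei; rewrite -ejE.
  - by apply/(inF_quo DD ps ex).
have [r [rE _]] := wH _ _ fE oE.
have [re reE] : exists g : {linear H -> H}, forall x, g x = r (e x).
  by apply: linear_ex => a x y; rewrite !linearP.
have [|b bK Kb] := bij re.
  by split=> // m; rewrite reE -ejE rE.
have [rho rhoE] : exists g : {linear E -> H}, forall x, g x = b (r x).
  apply: linear_ex => a x y; apply: (can_inj bK).
  by rewrite (linearP re) !Kb (linearP r).
have [psi psiE] : exists g : {linear E -> E}, forall x, g x = x - e (rho x).
  by apply: linear_ex => a x y; rewrite (linearP rho) (linearP e) scalerBr opprD addrACA.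
have [|s sE] := factor_ex ps (h := psi).
  by move=> x /ex[y <-]; rewrite psiE rhoE -reE bK subrr.
exists s => a; have [x <-] := ps a; rewrite sE psiE linearB.
have -> : p (e (rho x)) = 0 by apply/ex; exists (rho x).
by rewrite subr0.
Qed.

Theorem perfect_inF : perfect_cotorsion_pair (inF DD) (rperp (inF DD)).
Proof.
by split; [exact: cotorsion_inF | exact: covering_inF | exact: enveloping_inF].
Qed.
End Complete.

(** Each presentation of a module in CC contributes its two matrices to [DD], and [Ext1_exact]
    identifies the orthogonal of CC with [inF DD]. *)
Theorem perfect_rperp (R : pzRingType) (CC : mclass R) :
  (forall A, CC A -> exists k0 k1 k2 (e : {linear 'rV[R]_k0 -> A})
     (d0 : {linear 'rV[R]_k1 -> 'rV[R]_k0}) (d1 : {linear 'rV[R]_k2 -> 'rV[R]_k1}),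
     presentation e d0 d1) ->
  rperp CC (R^o : lmodType R) ->
  perfect_cotorsion_pair (rperp CC) (rperp (rperp CC)).
Proof.
move=> pres.
pose DD : pairs R := fun k0 k1 k2 D1 D2 => exists A, CC A /\
  exists (e : {linear 'rV[R]_k0 -> A})
     (d0 : {linear 'rV[R]_k1 -> 'rV[R]_k0}) (d1 : {linear 'rV[R]_k2 -> 'rV[R]_k1}),
  [/\ presentation e d0 d1, D1 = mx_of d0 & D2 = mx_of d1].
have -> : rperp CC = inF DD.
  rewrite predeqE => N; split=> [pN k0 k1 k2 D1 D2|FN A CA].
    move=> [A [CA [e [d0 [d1 [pr -> ->]]]]]] y _ y0.
    have [x xE] := (Ext1_exact N pr).1 (pN A CA) y y0.
    by exists x => // j; rewrite xE subrr.
  have [k0 [k1 [k2 [e [d0 [d1 pr]]]]]] := pres A CA.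
  apply/(Ext1_exact N pr) => y y0.
  have [||//|x _ xE] := FN k0 k1 k2 (mx_of d0) (mx_of d1) _ y.
  - by exists A; split=> //; exists e, d0, d1.
  - by [].
  by exists x => j; apply/subr0_eq/xE.
move=> FR; apply: perfect_inF => //.
move=> k0 k1 k2 _ _ [A [_ [e [d0 [d1 [[_ _ ex1] -> ->]]]]]] i l.
have : d0 (d1 (delta_mx 0 i)) = 0 by apply/ex1; exists (delta_mx 0 i).
rewrite row_linearE => /matrixP/(_ 0 l); rewrite summxE mxE => E.
by rewrite -[RHS]E; apply: eq_bigr => j _; rewrite mxE.
Qed.

Theorem theorem4p4 (R : pzRingType) :
  (forall n : nat, (1 < n)%N ->
     FPn_inj n (R^o : lmodType R) ->
     perfect_cotorsion_pair (FPn_inj (R:=R) n) (rperp (FPn_inj (R:=R) n)))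
  /\
  (FPinf_inj (R^o : lmodType R) ->
     perfect_cotorsion_pair (FPinf_inj (R:=R)) (rperp (FPinf_inj (R:=R)))).
Proof.
(* The bound n > 1 gives exactness of the first three free terms, which is the required presentation
   of length two. *)
split=> [n n1|]; apply: perfect_rperp => A [k [d [e [es ex0 exS]]]];
  exists (k 0%N), (k 1%N), (k 2%N), e, (d 0%N), (d 1%N); split=> //; last exact: exS.
  by apply: ex0; exact: ltnW.
Qed.
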